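(* For each constant $c>1$, we have $q^*(G_{n,c/n})>\frac{0.668}{\sqrt c}$ whp.
   Context: For a graph $G$ with $m\ge 1$ edges and a vertex partition $\mathcal A$, $q_{\mathcal A}(G)=\frac1m\sum_{A\in\mathcal A}e(A)-\frac{1}{4m^2}\sum_{A\in\mathcal A}\mathrm{vol}(A)^2$ ($e(A)$: number of edges within $A$; $\mathrm{vol}(A)$: sum of degrees in $A$); $q^*(G)=\max_{\mathcal A}q_{\mathcal A}(G)$. $G_{n,p}$ is the Erdős–Rényi random graph on $[n]$ with independent edge probability $p$; whp means with probability tending to $1$ as $n\to\infty$. *)

(* Defs.v *)
From HB Require Import structures.
From mathcomp Require Import all_boot all_order all_algebra.
From mathcomp Require Import reals.
Set Implicit Arguments.
Unset Strict Implicit.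
Unset Printing Implicit Defensive.
Import Order.TTheory GRing.Theory Num.Theory.
Local Open Scope ring_scope.

Record sgraph (V : finType) := SGraph {
  edges :> {set {set V}};
  edges_card2 : [forall e in edges, #|e| == 2]
}.

HB.instance Definition _ (V : finType) := [isSub for @edges V].
HB.instance Definition _ (V : finType) := [Countable of sgraph V by <:].
HB.instance Definition _ (V : finType) := [Finite of sgraph V by <:].

Section Modularity.
Variables (R : realType) (V : finType) (G : sgraph V).

Definition degree (v : V) : nat := #|[set e in edges G | v \in e]|.

Definition edges_within (A : {set V}) : nat :=
  #|[set e in edges G | e \subset A]|.

Definition volume (A : {set V}) : nat := (\sum_(v in A) degree v)%N.

(* Both terms are 0 when G has no edge, because x / 0 = 0: this is the usual
   convention for the modularity of an edgeless graph. *)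
Definition modularity (P : {set {set V}}) : R :=
  let m := #|edges G|%:R in
  (\sum_(A in P) (edges_within A)%:R) / m
  - (\sum_(A in P) (volume A)%:R ^+ 2) / (4 * m ^+ 2).

(* Big maxima need a base value: for nonempty V, [set setT] is itself one of
   the partitions over which the maximum is taken. *)
Definition max_modularity : R :=
  \big[Num.max/modularity [set [set: V]]]_(P : {set {set V}} |
      partition P [set: V]) modularity P.

End Modularity.

(* Probability of E for G_{n,p}; a probability only if 0 <= p <= 1. *)
Definition gnp_prob (R : realType) (n : nat) (p : R)
    (E : pred (sgraph 'I_n)) : R :=
  \sum_(G : sgraph 'I_n | E G)
    \prod_(e : {set 'I_n} | #|e| == 2) (if e \in edges G then p else 1 - p).

(* Main.v *)
(* Reveal the vertices one at a time and give each of them the label, among [K],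
   to which it sends the most edges, ties being broken by a uniform rotation of
   the labels. By symmetry each label is chosen with probability [1/K], so the [K]
   classes have volumes concentrated around [cn/K], while vertex [v] gains about
   the expected maximum of [K] independent Poisson variables of mean [pv/K]
   (martingale and Chebyshev bounds). With [g l] that expected maximum, the
   modularity of the partition is whp at least
   [(2 K / c^2) \int_0^(c/K) g - 1/K - o(1)]. For [c <= 6] take [K] large and bound
   [g] by the probability that the maximum is positive. For [c >= 6] take [K = 5]:
   Stein's identity gives a differential inequality for [g l - l] which makes
   [(g l - l - C) / sqrt l] nondecreasing, so certified values of [g] at finitely
   many points yield lower bounds [g l >= l + kappa sqrt l] for all [l]. *)

From Stdlib Require Import NArith Lia.
Require Import Defs.
From mathcomp Require Import all_boot all_order all_algebra.
From mathcomp Require Import all_classical all_reals all_analysis.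
From mathcomp Require Import ring lra.
Set Implicit Arguments.
Unset Strict Implicit.
Unset Printing Implicit Defensive.
Import Order.TTheory GRing.Theory Num.Theory.
Import numFieldNormedType.Exports.
Local Open Scope classical_set_scope.
Local Open Scope ring_scope.

(** * The expected maximum of Poisson variables *)

(** Why five labels: for large [l] the maximum of [K] Poisson variables exceeds [l] by about
    [kappa sqrt l], with [kappa] the expected maximum of [K] standard normals, and the bound becomes
    [(4 / 3) (kappa / sqrt K) / sqrt c]. The ratio [kappa / sqrt K] peaks at [K = 5], where the
    factor is about 0.693; the gap to 0.668 pays for certified numerics. The obstacle is uniformity
    in [l]: a limit theorem says nothing at a given [l], and computation reaches finitely many. The
    Gaussian profile [f = kappa sqrt l] solves [2 l f' = f]. The true [f = g l - l] satisfies this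
    up to a bounded error, so one certified value propagates to all larger [l] at an explicit cost.
    For small [c], large [K] makes the penalty [1 / K] negligible, and counting the vertices that
    have an earlier neighbour gives [(2 / c) (1 - (1 - e^-c) / c)]. This decays like [2 / c], hence
    the switch at [c = 6]. On the random side labels depend on the revealed edges. Symmetry makes
    the label of a vertex exactly uncorrelated with its number of back edges, so second moments
    suffice. *)

Lemma is_derive_le (R : realType) (f df : R -> R) (a b : R) : a <= b ->
  (forall x, a <= x <= b -> is_derive x 1 f (df x)) ->
  (forall x, a <= x <= b -> 0 <= df x) -> f a <= f b.
Proof.
move=> ab dfE df0; have [c cab||c cab E] := @MVT_segment R f df a b ab.
- by apply: dfE; move: cab; rewrite in_itv /= => /andP[/ltW -> /ltW ->].
- apply: continuous_in_subspaceT => x; rewrite inE /= in_itv /= => xab.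
  by apply/differentiable_continuous/derivable1_diffP; case: (dfE x xab).
rewrite -subr_ge0 E mulr_ge0 ?subr_ge0 //; apply: df0.
by move: cab; rewrite in_itv.
Qed.

Section Poisson.
Variable R : realType.
Implicit Types (l : R) (j k J : nat).

Definition pois l j : R := expR (- l) * (l ^+ j / j`!%:R).
Definition pcdf l j : R := \sum_(i < j) pois l i.
(* The expected maximum of [k] independent Poisson([l]) variables, each truncated
   at [J]; note that [pcdf l j] is the probability of being [< j]. *)
Definition emax k J l : R := \sum_(j < J) (1 - pcdf l j.+1 ^+ k).

Lemma pois_ge0 l j : 0 <= l -> 0 <= pois l j.
Proof. by move=> l0; rewrite mulr_ge0 ?expR_ge0 // divr_ge0 ?exprn_ge0. Qed.

Lemma pcdf0 l : pcdf l 0 = 0. Proof. by rewrite /pcdf big_ord0. Qed.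

Lemma pcdfS l j : pcdf l j.+1 = pcdf l j + pois l j.
Proof. by rewrite /pcdf big_ord_recr. Qed.

Lemma pcdf_ge0 l j : 0 <= l -> 0 <= pcdf l j.
Proof. by move=> l0; apply: sumr_ge0 => i _; apply: pois_ge0. Qed.

Lemma poisS l j : l * pois l j = j.+1%:R * pois l j.+1.
Proof.
rewrite /pois exprS factS natrM.
have h2 : j`!%:R != 0 :> R by rewrite pnatr_eq0 -lt0n fact_gt0.
by field; rewrite h2 nat1r pnatr_eq0.
Qed.

Lemma is_derive_pois0 l : is_derive l 1 (pois^~ 0%N) (- pois l 0).
Proof.
have D := is_derive1_comp (is_derive_expR (- l)) (is_deriveNid l 1).
have -> : pois^~ 0%N = expR \o -%R :> (R -> R).
  by apply/funext => x; rewrite /pois expr0 fact0 divr1 mulr1.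
by apply: is_derive_eq; rewrite /pois expr0 fact0 divr1 /=; lra.
Qed.

Lemma is_derive_poisS l j :
  is_derive l 1 (pois^~ j.+1) (pois l j - pois l j.+1).
Proof.
have D1 := is_derive1_comp (is_derive_expR (- l)) (is_deriveNid l 1).
have D2 := is_deriveX j.+1 (is_derive_id l (1 : R)).
have D := is_deriveZ (j.+1`!%:R^-1) (is_deriveM D1 D2).
have -> : pois^~ j.+1 = (j.+1`!%:R^-1 : R) \*: ((expR \o -%R) * (id ^+ j.+1)) :> (R -> R).
  apply/funext => x.
  change (pois x j.+1 = j.+1`!%:R^-1 * (expR (- x) * (id ^+ j.+1) x)).
  by rewrite exprfctE /pois mulrA mulrC.
apply: is_derive_eq.
rewrite /pois /GRing.scale /= exprfctE /= factS natrM.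
have h1 : j.+1%:R != 0 :> R by rewrite pnatr_eq0.
have h2 : j`!%:R != 0 :> R by rewrite pnatr_eq0 -lt0n fact_gt0.
by rewrite exprS; field; rewrite nat1r h1 h2.
Qed.

Lemma is_derive_pcdf l j : is_derive l 1 (pcdf^~ j.+1) (- pois l j).
Proof.
elim: j => [|j IH].
  have -> : pcdf^~ 1%N = pois^~ 0%N :> (R -> R).
    by apply/funext => x; rewrite pcdfS pcdf0 add0r.
  exact: is_derive_pois0.
have -> : pcdf^~ j.+2 = pcdf^~ j.+1 + pois^~ j.+1 :> (R -> R).
  by apply/funext => x; rewrite pcdfS.
have D := is_deriveD IH (is_derive_poisS l j).
by apply: is_derive_eq; ring.
Qed.

Lemma is_derive_emax k J l : is_derive l 1 (emax k.+1 J)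
  (\sum_(j < J) k.+1%:R * pcdf l j.+1 ^+ k * pois l j).
Proof.
have -> : emax k.+1 J = \sum_(j < J) (cst 1 - (pcdf^~ j.+1) ^+ k.+1) :> (R -> R).
  by apply/funext => x; rewrite /emax fct_sumE; apply: eq_bigr => j _; rewrite /= !fctE.
apply: is_derive_sum => j.
have D := is_deriveB (is_derive_cst (1 : R) l 1) (is_deriveX k.+1 (is_derive_pcdf l j)).
by apply: is_derive_eq; rewrite /GRing.scale /=; ring.
Qed.

Lemma pcdf_le l1 l2 j : 0 <= l1 <= l2 -> pcdf l2 j <= pcdf l1 j.
Proof.
case: j => [|j]; first by rewrite !pcdf0.
move=> /andP[l0 l12]; rewrite -lerN2.
apply: (@is_derive_le _ (fun l => - pcdf l j.+1) (fun l => pois l j)) => // x /andP[x1 x2].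
  have D := is_deriveN (is_derive_pcdf x j).
  by rewrite opprK in D; exact: D.
by apply: pois_ge0; apply: le_trans x1.
Qed.

Lemma pcdf_at0 j : pcdf 0 j.+1 = 1.
Proof.
rewrite /pcdf big_ord_recl big1 => [|i _]; rewrite /pois ?oppr0 expR0.
  by rewrite expr0 fact0 divr1 mulr1 addr0.
by rewrite expr0n /= mul0r mulr0.
Qed.

Lemma pcdf_le1 l j : 0 <= l -> pcdf l j <= 1.
Proof.
case: j => [|j]; first by rewrite pcdf0.
by move=> l0; rewrite -(pcdf_at0 j); apply: pcdf_le; rewrite lexx.
Qed.

Lemma pcdf_exp_le1 l j k : 0 <= l -> pcdf l j ^+ k <= 1.
Proof. by move=> l0; rewrite exprn_ile1 ?pcdf_le1 ?pcdf_ge0. Qed.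

Lemma emax_leJ k J J' l : 0 <= l -> (J <= J')%N -> emax k J l <= emax k J' l.
Proof.
move=> l0 /subnKC <-; rewrite /emax big_split_ord /= lerDl.
by apply: sumr_ge0 => i _; rewrite subr_ge0 pcdf_exp_le1.
Qed.

Lemma emax_le k J l1 l2 : 0 <= l1 <= l2 -> emax k J l1 <= emax k J l2.
Proof.
move=> l12; apply: ler_sum => j _; rewrite lerD2l lerN2.
have /andP[l0 l1'] := l12.
by rewrite lerXn2r ?nnegrE ?pcdf_le ?pcdf_ge0 // (le_trans l0).
Qed.

Lemma emax_lip k J l1 l2 : 0 <= l1 <= l2 ->
  emax k.+1 J l2 - emax k.+1 J l1 <= k.+1%:R * (l2 - l1).
Proof.
move=> /andP[l0 l12].
have D (x : R) : is_derive x 1 (fun l : R => k.+1%:R * l - emax k.+1 J l)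
   (k.+1%:R - \sum_(j < J) k.+1%:R * pcdf x j.+1 ^+ k * pois x j).
  have D1 := is_deriveZ (k.+1%:R : R) (is_derive_id x (1 : R)).
  have := is_deriveB D1 (is_derive_emax k J x).
  by move=> D; apply: is_derive_eq; rewrite /GRing.scale /= mulr1.
suff: k.+1%:R * l1 - emax k.+1 J l1 <= k.+1%:R * l2 - emax k.+1 J l2 by lra.
apply: (is_derive_le l12 (fun x _ => D x)) => x /andP[x1 _].
have x0 : 0 <= x by apply: le_trans x1.
rewrite subr_ge0 -[leRHS]mulr1 -[leRHS](mulr1).
under eq_bigr do rewrite -mulrA.
rewrite -mulr_sumr mulr1 ler_pM2l ?ltr0Sn //.
apply: le_trans (pcdf_le1 J x0); apply: ler_sum => j _.
by rewrite ler_piMl ?pois_ge0 ?pcdf_exp_le1.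
Qed.

(** The difference of the two sides vanishes at 0 and has derivative [- ln (1 - u^2) >= 0]. At
    [u = 1 / (2 (j + 1))] this is the logarithm of the reduced inequality in the next lemma,
    multiplied by [u]. *)
Lemma ln_half_step (u : R) : 0 <= u <= 1/2 ->
  (1 + u) * ln (1 + u) <= 2 * u + (1 - u) * ln (1 - u).
Proof.
move=> /andP[u0 u1].
have D (x : R) : 0 <= x <= u -> is_derive x 1
    (fun x : R => 2 * x + (1 - x) * ln (1 - x) - (1 + x) * ln (1 + x))
    (- ln ((1 - x) * (1 + x))).
  move=> /andP[x0 xu].
  have px : 0 < 1 - x by lra.
  have qx : 0 < 1 + x by lra.
  have A : is_derive x 1 (fun y : R => 1 - y) (0 - 1).
    exact: is_deriveB (is_derive_cst (1 : R) x 1) (is_derive_id x (1 : R)).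
  have B : is_derive x 1 (fun y : R => 1 + y) (0 + 1).
    exact: is_deriveD (is_derive_cst (1 : R) x 1) (is_derive_id x (1 : R)).
  have LA := @is_derive1_comp _ (@ln R) (fun y => 1 - y) x _ _ (is_derive1_ln px) A.
  have LB := @is_derive1_comp _ (@ln R) (fun y => 1 + y) x _ _ (is_derive1_ln qx) B.
  have F := is_deriveB (is_deriveD (is_deriveZ (2 : R) (is_derive_id x (1 : R)))
    (is_deriveM A LA)) (is_deriveM B LB).
  apply: (is_derive_eq F).
  rewrite lnM ?posrE // /GRing.scale /= [_ * ((1 - x)^-1 * _)]mulrA.
  by rewrite [_ * ((1 + x)^-1 * _)]mulrA !divff ?lt0r_neq0 //; lra.
have := is_derive_le u0 D; rewrite mulr0 subr0 addr0 ln1; move=> H.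
suff : 0 <= 2 * u + (1 - u) * ln (1 - u) - (1 + u) * ln (1 + u) by lra.
apply: le_trans (H _) => [|x /andP[x0 xu]]; first by lra.
by rewrite oppr_ge0 ln_le0 //; nra.
Qed.

(** Ratio of two consecutive instances of [pois_peak]. Removing the powers of [j + 1] leaves
    [(1 + u)^(2j+3) e^-2 <= (1 - u)^(2j+1)], whose exponents are [(1 + u) / u] and [(1 - u) / u]. *)
Lemma pois_peak_step j :
  (j%:R + 3 / 2) ^+ (2 * j + 3) * expR (- 2) <=
  (j%:R + 1 / 2) ^+ (2 * j + 1) * j.+1%:R ^+ 2 :> R.
Proof.
set N : R := j.+1%:R.
have N1 : 1 <= N by rewrite ler1n.
have jN : j%:R = N - 1 :> R by rewrite /N -natr1 addrK.
clearbody N.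
have N0 : N != 0 by rewrite gt_eqF //; lra.
set u := 1 / (2 * N).
have uN : u * N = 1 / 2 by rewrite /u; field; rewrite N0.
have u0 : 0 < u by rewrite divr_gt0 //; lra.
clearbody u; have u1 : u <= 1 / 2 by nra.
have -> : j%:R + 3 / 2 = N * (1 + u) by nra.
have -> : j%:R + 1 / 2 = N * (1 - u) by nra.
have -> : (2 * j + 3 = (2 * j + 1) + 2)%N by rewrite -addnA.
suff H : (1 + u) ^+ (2 * j + 1 + 2) * expR (- 2) <= (1 - u) ^+ (2 * j + 1).
  have NN : 0 <= N ^+ (2 * j + 1) * N ^+ 2 by rewrite mulr_ge0 ?exprn_ge0 //; lra.
  rewrite !exprMn [N ^+ (_ + _)]exprD -mulrA [leRHS]mulrAC.
  by apply: ler_wpM2l.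
have pa : 0 < 1 + u by lra.
have pb : 0 < 1 - u by lra.
rewrite -ler_ln ?posrE ?mulr_gt0 ?exprn_gt0 ?expR_gt0 //.
rewrite lnM ?posrE ?exprn_gt0 ?expR_gt0 // expRK !lnXn //.
rewrite -[_ *+ (2 * j + 1 + 2)]mulr_natl -[_ *+ (2 * j + 1)]mulr_natl.
have -> : (2 * j + 1 + 2)%:R = (1 + u) / u :> R.
  rewrite natrD natrD natrM jN.
  by apply: (mulIf (lt0r_neq0 u0)); rewrite divfK ?lt0r_neq0 //; nra.
have -> : (2 * j + 1)%:R = (1 - u) / u :> R.
  rewrite natrD natrM jN.
  by apply: (mulIf (lt0r_neq0 u0)); rewrite divfK ?lt0r_neq0 //; nra.
have := ln_half_step (u := u); rewrite (ltW u0) u1 => /(_ isT) H.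
rewrite -(ler_pM2r u0).
rewrite mulrDl mulrAC divfK ?lt0r_neq0 // [X in _ <= X]mulrAC divfK ?lt0r_neq0 //; lra.
Qed.

(** The point [j + 1/2] maximizes [l^(2j+1) e^(-2l)], so this is the worst case over [l] of the next
    lemma. Equality holds at [j = 0], the origin of the constant [1 / (2 e)]. *)
Lemma pois_peak j :
  (j%:R + 1 / 2) ^+ (2 * j + 1) * expR (- (2 * j + 1)%:R) <=
  expR (- 1) / 2 * j`!%:R ^+ 2 :> R.
Proof.
elim: j => [|j IH]; first by rewrite fact0 add0r muln0 expr1 expr1n mulr1; lra.
have -> : (2 * j.+1 + 1 = 2 * j + 3)%N by rewrite mulnS addnAC addnC addnA.
have -> : j.+1%:R + 1 / 2 = j%:R + 3 / 2 :> R by rewrite -natr1; lra.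
have -> : - (2 * j + 3)%:R = - 2 + (- (2 * j + 1)%:R) :> R by rewrite natrD [(_ + 1)%:R]natrD; lra.
rewrite expRD mulrA.
apply: le_trans (ler_wpM2r (expR_ge0 _) (pois_peak_step j)) _.
rewrite [leLHS]mulrAC factS natrM exprMn [leRHS]mulrCA [leLHS]mulrC.
by apply: ler_wpM2l; rewrite ?exprn_ge0.
Qed.

(** Squared point masses are [O(1 / l)] uniformly in [j], which is what keeps the error in
    [emax_ode] bounded as [l] grows. Comparison with the peak [m = j + 1/2] is [t <= e^(t - 1)] at
    [t = l / m]. *)
Lemma pois_sqr_le l j : 0 <= l -> l * pois l j ^+ 2 <= expR (- 1) / 2.
Proof.
move=> l0.
have f0 : 0 < j`!%:R :> R by rewrite ltr0n fact_gt0.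
have -> : l * pois l j ^+ 2 =
    (l ^+ (2 * j + 1) * expR (- (2 * l))) / j`!%:R ^+ 2.
  rewrite /pois (_ : - (2 * l) = - l - l); last lra.
  rewrite expRD exprD mulnC exprM expr1; field.
  by rewrite gt_eqF.
rewrite ler_pdivrMr ?exprn_gt0 //; apply: le_trans (pois_peak j).
set m : R := j%:R + 1 / 2.
have m0 : 0 < m by rewrite /m ltr_wpDl //; lra.
have -> : - (2 * l) = (2 * j + 1)%:R * (1 - l / m) - (2 * j + 1)%:R.
  have -> : (2 * j + 1)%:R = 2 * m by rewrite natrD natrM /m; lra.
  by field; rewrite gt_eqF.
rewrite expRD mulrA ler_pM2r ?expR_gt0 // expRM_natl -exprMn.
rewrite lerXn2r ?nnegrE ?(ltW m0) ?mulr_ge0 ?expR_ge0 //.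
have : l / m <= expR (l / m - 1) by have := expR_ge1Dx (l / m - 1); lra.
rewrite ler_pdivrMr // => H.
have -> : 1 - l / m = - (l / m - 1) by lra.
rewrite expRN ler_pdivrMr ?expR_gt0 //; lra.
Qed.

(** [hdiv4 a b] is [(b^5 - a^5) / (b - a)] and [hdiv3 a b] is [(5 b^4 - hdiv4 a b) / (b - a)],
    written as polynomials so that [a = b] is harmless. *)
Definition hdiv4 (a b : R) := b ^+ 4 + a * b ^+ 3 + a ^+ 2 * b ^+ 2 + a ^+ 3 * b + a ^+ 4.
Definition hdiv3 (a b : R) := 4 * b ^+ 3 + 3 * a * b ^+ 2 + 2 * a ^+ 2 * b + a ^+ 3.

(** Summation by parts turns the expected maximum into a sum of [j p_j hdiv4 F_j F_(j+1)], and
    Stein's identity [j p_j = l p_(j-1)] extracts the factor [l]. The last term is the boundary term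
    of the truncation at [J]. *)
Lemma emax_stein J l : emax 5 J l =
  l * (\sum_(j < J) pois l j * hdiv4 (pcdf l j.+1) (pcdf l j.+2))
  + J%:R * (1 - pcdf l J.+1 ^+ 5).
Proof.
elim: J => [|J IH]; first by rewrite /emax !big_ord0 mulr0 mul0r addr0.
rewrite /emax big_ord_recr /= -/(emax 5 J l) IH big_ord_recr /=.
rewrite [l * (_ + _)]mulrDr [l * (pois l J * _)]mulrA poisS.
rewrite (pcdfS l J.+1) -natr1 /hdiv4; ring.
Qed.

Lemma sum_pois_hdiv4 J l :
  \sum_(j < J) pois l j * hdiv4 (pcdf l j) (pcdf l j.+1) = pcdf l J ^+ 5.
Proof.
elim: J => [|J IH]; first by rewrite big_ord0 pcdf0 expr0n.
by rewrite big_ord_recr /= IH pcdfS /hdiv4; ring.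
Qed.

Lemma hdiv3_le (a b a' b' : R) : 0 <= a <= a' -> 0 <= b <= b' -> hdiv3 a b <= hdiv3 a' b'.
Proof.
move=> /andP[a0 aa] /andP[b0 bb]; rewrite /hdiv3.
have a20 : a ^+ 2 <= a' ^+ 2 by rewrite lerXn2r ?nnegrE ?(le_trans a0).
have b20 : b ^+ 2 <= b' ^+ 2 by rewrite lerXn2r ?nnegrE ?(le_trans b0).
have a3 : a ^+ 3 <= a' ^+ 3 by rewrite lerXn2r ?nnegrE ?(le_trans a0).
have b3 : b ^+ 3 <= b' ^+ 3 by rewrite lerXn2r ?nnegrE ?(le_trans b0).
have m1 : a * b ^+ 2 <= a' * b' ^+ 2 by apply: ler_pM; rewrite ?exprn_ge0.
have m2 : a ^+ 2 * b <= a' ^+ 2 * b' by apply: ler_pM; rewrite ?exprn_ge0.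
lra.
Qed.

(* With [h_j = hdiv3 F_j F_(j+1)] the double divided difference of [x^5], one has
   [10 F_(j+1)^4 - S_j - S_(j+1) = p_j h_j - p_(j+1) l_j] where
   [h_j <= l_j <= h_(j+1)], so that AM-GM makes the sum telescope. *)
Lemma sum_pois_defect P J l : 0 <= l -> (forall j, pois l j ^+ 2 <= P) ->
  - (1 / 2) * (pois l J ^+ 2 + P) * hdiv3 (pcdf l J) (pcdf l J.+1) <=
  \sum_(j < J) pois l j * (10 * pcdf l j.+1 ^+ 4
     - hdiv4 (pcdf l j) (pcdf l j.+1) - hdiv4 (pcdf l j.+1) (pcdf l j.+2)).
Proof.
move=> l0 hP; elim: J => [|J IH].
  rewrite big_ord0 -mulrA mulNr oppr_le0 mulr_ge0 ?divr_ge0 //.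
  have P0 : 0 <= P by apply: le_trans (hP 0%N); apply: sqr_ge0.
  by rewrite mulr_ge0 ?addr_ge0 ?sqr_ge0 // ?mulr_ge0 ?exprn_ge0 ?pcdf_ge0.
rewrite big_ord_recr /=; apply: le_trans (lerD IH (lexx _)).
have := pcdf_ge0 J l0; have := pois_ge0 J l0; have := pois_ge0 J.+1 l0.
have := hP J; rewrite !pcdfS.
move: (pcdf l J) (pois l J) (pois l J.+1) => a p q hp q0 p0 a0.
set b := a + p; set d := b + q.
pose h := hdiv3 a b; pose h' := hdiv3 b d.
pose m := d ^+ 3 + 2 * b * d ^+ 2 + 3 * b ^+ 2 * d + 4 * b ^+ 3.
have -> : 10 * b ^+ 4 - hdiv4 a b - hdiv4 b d = p * h - q * m.
  by rewrite /h /m /hdiv4 /hdiv3 /d /b; ring.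
have b0 : 0 <= b by rewrite addr_ge0.
have d0 : 0 <= d by rewrite addr_ge0.
have ab : a <= b by rewrite lerDl.
have bd : b <= d by rewrite lerDl.
have hm : h <= m.
  have -> : m = hdiv3 b b + (d - b) * (d ^+ 2 + d * b + b ^+ 2 + 2 * b * (d + b) + 3 * b ^+ 2).
    by rewrite /m /hdiv3; ring.
  apply: le_trans (hdiv3_le (a' := b) (b' := b) _ _) _; rewrite ?a0 ?b0 ?ab ?lexx //.
  by rewrite lerDl mulr_ge0 ?subr_ge0 // !addr_ge0 ?mulr_ge0 ?addr_ge0 ?exprn_ge0.
have mh : m <= h'.
  rewrite -subr_ge0.
  have -> : h' - m = (d - b) * (3 * d ^+ 2 + 4 * b * d + 3 * b ^+ 2).
    by rewrite /m /h' /hdiv3; ring.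
  by rewrite mulr_ge0 ?subr_ge0 // !addr_ge0 ?mulr_ge0 ?exprn_ge0.
rewrite -/h -/h'; have m0 : 0 <= m.
  by rewrite /m !addr_ge0 ?mulr_ge0 ?exprn_ge0.
have amgm : 0 <= m * (p - q) ^+ 2 by rewrite mulr_ge0 ?sqr_ge0.
have t1 : 0 <= (P - p ^+ 2) * (m - h) by rewrite mulr_ge0 ?subr_ge0.
have t2 : 0 <= P * (h' - m).
  by rewrite mulr_ge0 ?subr_ge0 //; apply: le_trans hp; apply: sqr_ge0.
have t3 : 0 <= q ^+ 2 * (h' - m) by rewrite mulr_ge0 ?subr_ge0 ?sqr_ge0.
clear -amgm t1 t2 t3; nra.
Qed.

(** Approximate form of [2 l f' = f] for [f = emax - l]. Twice the derivative is the Stein sum plus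
    [F_J^5] plus the defect sum bounded above; there [hdiv3 <= hdiv3 1 1 = 10] and [l P = 1 / (2 e)]
    yield the constant [5 / (2 e)]. All other errors are multiples of the tail [1 - F_J]. *)
Lemma emax_ode J l : 0 <= l ->
  - (5 / 2 * expR (- 1) + (10 * l + 5 * J%:R) * (1 - pcdf l J)) <=
  2 * l * (\sum_(j < J) 5%:R * pcdf l j.+1 ^+ 4 * pois l j - 1) - (emax 5 J l - l).
Proof.
move=> l0; case: (ltrgtP l 0) l0 => // [lp|-> _]; last first.
  rewrite !mulr0 mul0r; case: J => [|J].
    rewrite /emax big_ord0 pcdf0; have := expR_ge0 (-1 : R); lra.
  rewrite pcdf_at0 subrr mulr0 [emax _ _ _]big1 => [|i _].
    have := expR_ge0 (-1 : R); lra.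
  by rewrite pcdf_at0 expr1n subrr.
move=> _; have l0 := ltW lp.
set P := expR (-1) / 2 / l.
have hP j : pois l j ^+ 2 <= P.
  by rewrite ler_pdivlMr // mulrC pois_sqr_le.
have := sum_pois_defect J l0 hP.
set W := \sum_(j < J) _ => HW.
set E := \sum_(j < J) _.
rewrite [emax 5 J l]emax_stein.
set S := \sum_(j < J) _.
have EW : 2 * E = W + S + pcdf l J ^+ 5.
  rewrite -sum_pois_hdiv4 /W /S /E mulr_sumr -!big_split /=.
  by apply: eq_bigr => j _; ring.
have H10 : hdiv3 (pcdf l J) (pcdf l J.+1) <= 10.
  apply: le_trans (hdiv3_le (a' := 1) (b' := 1) _ _) _; rewrite ?pcdf_ge0 ?pcdf_le1 //.
  by rewrite /hdiv3 !expr1n; lra.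
have H0 : 0 <= hdiv3 (pcdf l J) (pcdf l J.+1).
  by rewrite /hdiv3 !addr_ge0 ?mulr_ge0 ?exprn_ge0 ?pcdf_ge0.
set tau : R := 1 - pcdf l J.
have pt : pois l J <= tau.
  by rewrite /tau lerBrDl -pcdfS pcdf_le1.
have p0 := pois_ge0 J l0.
have t1 : tau <= 1 by rewrite /tau lerBlDr lerDl pcdf_ge0.
have p2 : pois l J ^+ 2 <= tau by rewrite expr2; nra.
have HW' : - 5 * (tau + P) <= W.
  apply: le_trans HW.
  have : 0 <= P by rewrite /P !divr_ge0 ?expR_ge0.
  have : 0 <= pois l J ^+ 2 by rewrite exprn_ge0.
  nra.
have PL : l * P = expR (-1) / 2 by rewrite /P mulrC divfK // gt_eqF.
have pow5 (x : R) : 0 <= x <= 1 -> 1 - x ^+ 5 <= 5 * (1 - x).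
  move=> /andP[x0 x1]; have -> : 1 - x ^+ 5 = (1 - x) * hdiv4 x 1.
    by rewrite /hdiv4; ring.
  rewrite mulrC ler_wpM2r ?subr_ge0 // /hdiv4 !expr1n !mulr1.
  have := exprn_ile1 2 x0 x1; have := exprn_ile1 3 x0 x1; have := exprn_ile1 4 x0 x1; lra.
have e1 : 1 - pcdf l J ^+ 5 <= 5 * tau by apply: pow5; rewrite pcdf_ge0 ?pcdf_le1.
have e2 : 1 - pcdf l J.+1 ^+ 5 <= 5 * tau.
  apply: le_trans (pow5 _ _) _; first by rewrite pcdf_ge0 ?pcdf_le1.
  by rewrite ler_pM2l // lerD2l lerN2 pcdfS lerDl.
have e3 : J%:R * (1 - pcdf l J.+1 ^+ 5) <= J%:R * (5 * tau) by apply: ler_wpM2l.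
have e4 : l * (1 - pcdf l J ^+ 5) <= l * (5 * tau) by apply: ler_wpM2l.
have e5 : l * (- 5 * (tau + P)) <= l * W by apply: ler_wpM2l.
have -> : 2 * l * (E - 1) = l * (2 * E) - 2 * l by ring.
rewrite EW.
have e6 : l * (- 5 * (tau + P)) = - 5 * (l * tau) - 5 * (l * P) by ring.
rewrite e6 PL in e5.
clear -e3 e4 e5; clearbody tau; lra.
Qed.

Lemma pcdf_tail L l J : 0 <= l <= L -> 1 - pcdf l J.+1 <= L * (L ^+ J / J`!%:R).
Proof.
move=> /andP[l0 lL]; have L0 : 0 <= L := le_trans l0 lL.
have f0 : 0 <= J`!%:R^-1 :> R by rewrite invr_ge0.
set u := L ^+ J / _.
apply: (@le_trans _ _ (1 - pcdf L J.+1)); first by rewrite lerD2l lerN2 pcdf_le // l0.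
have D (x : R) : is_derive x 1 (fun x : R => u * x + pcdf x J.+1) (u - pois x J).
  have D1 := is_deriveZ u (is_derive_id x (1 : R)).
  have := is_deriveD D1 (is_derive_pcdf x J).
  by move=> D; apply: is_derive_eq; rewrite /GRing.scale /= mulr1.
have H := @is_derive_le R _ _ 0 L L0 (fun x _ => D x).
suff : u * 0 + pcdf 0 J.+1 <= u * L + pcdf L J.+1 by rewrite mulr0 pcdf_at0; lra.
apply: H => x /andP[x0 xL].
rewrite subr_ge0 /pois -[leRHS]mul1r ler_pM ?expR_ge0 ?expR_le1 ?oppr_le0 //.
  by rewrite mulr_ge0 ?exprn_ge0.
by rewrite ler_wpM2r // lerXn2r ?nnegrE.
Qed.

Lemma pcdf_tail_small (L eta : R) : 0 <= L -> 0 < eta -> exists J0, forall J l,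
  (J0 <= J)%N -> 0 <= l <= L -> (10 * l + 5 * J%:R) * (1 - pcdf l J) <= eta.
Proof.
move=> L0 e0; pose K := (10 * L + 5) * L + 5 * L * L + 1.
have K0 : 0 < K by rewrite /K ltr_wpDl // addr_ge0 ?mulr_ge0 ?addr_ge0 ?mulr_ge0.
have /cvgrPdist_le /(_ (eta / K)) := @cvg_exp_coeff R L.
rewrite divr_gt0 // => /(_ isT) [N _ HN]; exists N.+2 => -[//|[//|J]] l.
rewrite !ltnS => NJ lL; have /andP[l0 lL'] := lL.
have u i : (N <= i)%N -> L ^+ i / i`!%:R <= eta / K.
  move=> Ni; have := HN i Ni; rewrite /= sub0r normrN /exp_coeff => /(le_trans _); apply.
  exact: ler_norm.
have t1 := pcdf_tail J.+1 lL.
have u1 := u J.+1 (leqW NJ); have u0 := u J NJ.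
(* The factor [J] in front of the tail is absorbed by one factor of the factorial. *)
have E : J.+1%:R * (L ^+ J.+1 / J.+1`!%:R) = L * (L ^+ J / J`!%:R).
  rewrite factS natrM exprS.
  have h2 : J`!%:R != 0 :> R by rewrite pnatr_eq0 -lt0n fact_gt0.
  by field; rewrite h2 nat1r pnatr_eq0.
move: t1 u1 u0 E; set v1 := L ^+ J.+1 / _; set v0 := L ^+ J / _; set e := eta / K => t1 u1 u0 E.
have v10 : 0 <= v1 by rewrite divr_ge0 ?exprn_ge0.
apply: (@le_trans _ _ ((10 * L + 5 * J.+2%:R) * (L * v1))).
  apply: ler_pM => //; rewrite ?subr_ge0 ?pcdf_le1 ?addr_ge0 ?mulr_ge0 //.
  by rewrite lerD2r ler_pM2l.
have -> : (10 * L + 5 * J.+2%:R) * (L * v1) = (10 * L + 5) * L * v1 + 5 * L * (J.+1%:R * v1).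
  by rewrite -[J.+2%:R]natr1; ring.
rewrite E; have -> : eta = K * e by rewrite /e mulrC divfK ?gt_eqF.
have -> : K * e = (10 * L + 5) * L * e + 5 * L * (L * e) + e by rewrite /K; ring.
have e00 : 0 <= e by rewrite divr_ge0 ?ltW.
rewrite -[leLHS]addr0 lerD // lerD // ?ler_wpM2l ?mulr_ge0 ?addr_ge0 ?mulr_ge0 //.
Qed.

(** The derivative of the quotient is [(2 l f' - f + C) / (2 l^(3/2))] with [f = emax - l],
    nonnegative by [emax_ode] as soon as [C] covers its error. *)
Lemma emax5_sqrt_mono J (eta C a b : R) : 0 < a -> a <= b ->
  (forall l, 0 <= l <= b -> (10 * l + 5 * J%:R) * (1 - pcdf l J) <= eta) ->
  5 / 2 * expR (- 1) + eta <= C ->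
  (emax 5 J a - a - C) / Num.sqrt a <= (emax 5 J b - b - C) / Num.sqrt b.
Proof.
move=> a0 ab H hC.
pose f (x : R) := emax 5 J x - x - C.
have D (x : R) : a <= x <= b -> is_derive x 1 (fun x => f x * (Num.sqrt x)^-1)
   (((2 * x * (\sum_(j < J) 5%:R * pcdf x j.+1 ^+ 4 * pois x j - 1) - f x))
     / (2 * (Num.sqrt x) ^+ 3)).
  move=> /andP[ax xb]; have x0 : 0 < x by apply: lt_le_trans ax.
  have s0 : 0 < Num.sqrt x by rewrite sqrtr_gt0.
  have Df : is_derive x 1 f (\sum_(j < J) 5%:R * pcdf x j.+1 ^+ 4 * pois x j - 1 - 0).
    exact: is_deriveB (is_deriveB (is_derive_emax 4 J x) (is_derive_id x (1 : R)))
      (is_derive_cst C x 1).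
  have Dv := is_deriveV (lt0r_neq0 s0) (is_derive1_sqrt x0).
  apply: (is_derive_eq (is_deriveM Df Dv)).
  rewrite /GRing.scale /= -[X in 2 * X * _]sqr_sqrtr ?(ltW x0) //.
  by move: (Num.sqrt x) s0 => s s0; field; rewrite gt_eqF.
apply: (is_derive_le ab D) => x /andP[ax xb].
have x0 : 0 < x by apply: lt_le_trans ax.
rewrite divr_ge0 ?mulr_ge0 ?exprn_ge0 ?sqrtr_ge0 // /f.
have := emax_ode J (ltW x0); have := H x; rewrite xb (ltW x0) => /(_ isT).
lra.
Qed.

End Poisson.

(** * Certified lower bounds for five labels *)

(* With [l = x/y]: [u] and [d] are integer upper and lower bounds of [B l^i / i!] for
   a fixed scale [B], [U] and [D] those of its partial sums. All the successive [U]
   and the last [D] are returned, so [U/D] bounds the Poisson distribution function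
   from above without any exponential. *)
Fixpoint pois_loop (n : nat) (x y i u d U D : N) : N * seq N :=
  if n is n'.+1 then
    let U' := N.add U u in
    let v := N.mul y (N.succ i) in
    let r := pois_loop n' x y (N.succ i)
      (N.succ (N.div (N.mul u x) v)) (N.div (N.mul d x) v) U' (N.add D d) in
    (r.1, U' :: r.2)
  else (D, [::]).

Definition pow5 (a : N) : N := N.mul (N.mul (N.mul a a) (N.mul a a)) a.
Arguments pow5 : simpl never.

(* The shift by [k] only discards superfluous precision when [B e^l] is huge. *)
Definition emax_lower (s : N) (n : nat) (x y k : N) : N * N :=
  let r := pois_loop n x y 0%num s s 0%num 0%num in
  let D := N.shiftr r.1 k in
  let D5 := pow5 D in
  (foldr (fun U s => N.add (N.sub D5 (pow5 (N.succ (N.shiftr U k)))) s) 0%num r.2, D5).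

(* A point [((a, g), (n, k))] asserts [g / 1000 <= emax 5 J l - l] at
   [sqrt l = a / 100], for every [J >= n]; the scale [B] is [2^40]. *)
Definition point_ok (t : (N * N) * (nat * N)) : bool :=
  let: ((a, g), (n, k)) := t in
  let r := emax_lower 1099511627776%num n (N.mul a a) 10000%num k in
  (N.ltb 0 r.2) && N.leb (N.mul r.2 (N.add (N.mul a a) (N.mul g 10))) (N.mul r.1 10000).

(* Here [93 / 100] bounds [5 / (2 e) + 1 / 100], the constant of the monotone
   quantity [(emax 5 J l - l - C) / sqrt l]. *)
Definition step_ok (kap a b g : N) : bool :=
  N.leb (N.add (N.mul (N.mul kap a) b) (N.mul 93 (N.mul 1000 b)))
        (N.add (N.mul (N.mul 100 g) b) (N.mul 93 (N.mul 1000 a))).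
Arguments step_ok : simpl never.
Arguments point_ok : simpl never.

Fixpoint chain_ok (kap : N) (s : seq ((N * N) * (nat * N))) (e : N) : bool :=
  if s is t :: s' then
    let: ((a, g), _) := t in
    let b := if s' is ((b, _), _) :: _ then b else e in
    [&& point_ok t, N.ltb 0 a, N.ltb 0 b, step_ok kap a b g & chain_ok kap s' e]
  else true.

(** The gaps widen with [a] because moving from [a] to [b] costs only [C (1 / a - 1 / b)]. The
    shifts leave [D] about 24 bits, whatever the size of [e^l]. *)
Definition points_small : seq ((N * N) * (nat * N)) := ([::
  ((55, 670), (16%nat, 16)); ((56, 684), (16%nat, 16));
  ((58, 711), (16%nat, 16)); ((60, 737), (17%nat, 16));
  ((62, 763), (17%nat, 16)); ((65, 802), (17%nat, 16));
  ((68, 840), (17%nat, 16)); ((71, 877), (18%nat, 16));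
  ((75, 927), (18%nat, 16)); ((79, 976), (18%nat, 16));
  ((84, 1037), (19%nat, 17)); ((90, 1110), (20%nat, 17));
  ((96, 1183), (20%nat, 17)); ((103, 1269), (21%nat, 17))])%num.

Definition points_large : seq ((N * N) * (nat * N)) := ([::
  ((109, 1341), (21%nat, 17)); ((125, 1534), (23%nat, 18));
  ((145, 1773), (25%nat, 19)); ((172, 2094), (28%nat, 20));
  ((209, 2530), (33%nat, 22)); ((261, 3141), (39%nat, 25));
  ((339, 4054), (50%nat, 32)); ((466, 5537), (70%nat, 47));
  ((702, 8286), (117%nat, 87)); ((1271, 14908), (275%nat, 249))])%num.

Lemma points_small_ok : chain_ok 1160 points_small 109.
Proof. by vm_compute. Qed.

Lemma points_large_ok : chain_ok 1121 points_large 2000.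
Proof. by vm_compute. Qed.

(** Here [(23.388 - 0.93) / 20 > 65 / 58], so beyond [sqrt l = 20] monotonicity alone suffices and
    no further point is needed. *)
Lemma point_last_ok : point_ok ((2000%num, 23388%num), (572, 593%num)).
Proof. by vm_compute. Qed.

Section Certificate.
Variable R : realType.

Definition Nr (a : N) : R := (N.to_nat a)%:R.

Lemma Nr_add a b : Nr (N.add a b) = Nr a + Nr b.
Proof. by rewrite /Nr N2Nat.inj_add -natrD. Qed.

Lemma Nr_mul a b : Nr (N.mul a b) = Nr a * Nr b.
Proof. by rewrite /Nr N2Nat.inj_mul -natrM. Qed.

Lemma Nr_ge0 a : 0 <= Nr a. Proof. exact: ler0n. Qed.

Lemma Nr_le a b : N.le a b -> Nr a <= Nr b.
Proof. by move=> h; rewrite ler_nat; apply/ssrnat.leP; lia. Qed.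

Lemma Nr_lt a b : N.lt a b -> Nr a < Nr b.
Proof. by move=> h; rewrite ltr_nat; apply/ssrnat.ltP; lia. Qed.

Lemma Nr_pow5 a : Nr (pow5 a) = Nr a ^+ 5.
Proof. by rewrite /pow5 !Nr_mul; ring. Qed.

Lemma foldr_sub_pow5 (s : seq N) (f : N -> N) D (F : nat -> R) :
  (forall j, 0 <= F j <= 1) ->
  (forall j, (j < size s)%N -> F j * Nr D <= Nr (f (nth 0%num s j))) ->
  Nr (foldr (fun U t => N.add (N.sub (pow5 D) (pow5 (f U))) t) 0%num s) <=
  (\sum_(j < size s) (1 - F j ^+ 5)) * Nr D ^+ 5.
Proof.
elim: s F => [|U s IH] F F01 hF /=; first by rewrite big_ord0 mul0r.
rewrite Nr_add big_ord_recl /= mulrDl lerD //; last first.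
  by apply: (IH (fun j => F j.+1)) => // j js; apply: (hF j.+1).
have := hF 0%N isT => /= h0; have /andP[F0 F1] := F01 0%N.
have h5 : (F 0%N * Nr D) ^+ 5 <= Nr (f U) ^+ 5.
  by rewrite lerXn2r ?nnegrE ?mulr_ge0 ?Nr_ge0.
case: (N.le_gt_cases (pow5 (f U)) (pow5 D)) => [le|lt].
  have : Nr (N.sub (pow5 D) (pow5 (f U))) + Nr (pow5 (f U)) = Nr (pow5 D).
    by rewrite -Nr_add; congr Nr; lia.
  rewrite !Nr_pow5; rewrite exprMn in h5; lra.
(* Truncated subtraction returns 0, still a lower bound because [F 0 <= 1]. *)
have -> : N.sub (pow5 D) (pow5 (f U)) = 0%num by lia.
by rewrite mulr_ge0 ?exprn_ge0 ?Nr_ge0 // subr_ge0 exprn_ile1.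
Qed.

Lemma Nr_div_le a b : N.lt 0 b -> Nr (N.div a b) * Nr b <= Nr a.
Proof. by move=> b0; rewrite mulrC -Nr_mul; apply/Nr_le/N.Div0.mul_div_le. Qed.

Lemma Nr_div_ge a b : N.lt 0 b -> Nr a <= Nr (N.succ (N.div a b)) * Nr b.
Proof.
move=> b0; rewrite mulrC -Nr_mul; apply/Nr_le/N.lt_le_incl/N.mul_succ_div_gt; lia.
Qed.

Lemma pois_loop_spec (alpha l : R) x y n i u d U D :
  N.lt 0 y -> 0 <= alpha -> 0 <= l -> l * Nr y = Nr x ->
  let w (j : nat) := alpha * (l ^+ j / j`!%:R) in
  w (N.to_nat i) <= Nr u -> Nr d <= w (N.to_nat i) ->
  \sum_(j < N.to_nat i) w j <= Nr U -> Nr D <= \sum_(j < N.to_nat i) w j ->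
  let r := pois_loop n x y i u d U D in
  [/\ Nr r.1 <= \sum_(j < N.to_nat i + n) w j, size r.2 = n &
   forall j, (j < n)%N -> \sum_(m < (N.to_nat i + j).+1) w m <= Nr (nth 0%num r.2 j)].
Proof.
move=> y0 a0 l0 xy w; elim: n i u d U D => [|n IH] i u d U D hu hd hU hD /=.
  by rewrite addn0.
set v := N.mul y (N.succ i).
have v0 : N.lt 0 v by rewrite /v; lia.
have Ei : N.to_nat (N.succ i) = (N.to_nat i).+1 by rewrite N2Nat.inj_succ.
have ws : w (N.to_nat i).+1 * Nr v = w (N.to_nat i) * Nr x.
  rewrite /w -xy /v Nr_mul {2}/Nr Ei exprS factS natrM.
  have h2 : (N.to_nat i)`!%:R != 0 :> R by rewrite pnatr_eq0 -lt0n fact_gt0.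
  by field; rewrite h2 nat1r pnatr_eq0.
have vp : 0 < Nr v by have := Nr_lt v0.
have [] := IH (N.succ i) (N.succ (N.div (N.mul u x) v)) (N.div (N.mul d x) v)
  (N.add U u) (N.add D d).
- rewrite Ei -(ler_pM2r vp) ws; apply: le_trans (Nr_div_ge _ v0).
  by rewrite Nr_mul ler_wpM2r ?Nr_ge0.
- rewrite Ei -(ler_pM2r vp) ws; apply: le_trans (Nr_div_le _ v0) _.
  by rewrite Nr_mul ler_wpM2r ?Nr_ge0.
- by rewrite Ei big_ord_recr /= Nr_add lerD.
- by rewrite Ei big_ord_recr /= Nr_add lerD.
rewrite Ei => h1 h2 h3; split; first by rewrite addnS -addSn.
  by rewrite /= h2.
case=> [|j]; first by rewrite addn0 big_ord_recr /= Nr_add => _; apply: lerD.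
by rewrite ltnS => jn; rewrite addnS -addSn; apply: h3.
Qed.

(** The distribution function is a partial sum of [b l^i / i!] divided by [b e^l]. Since [D] stays
    below [b e^l] and each [U] above its partial sum, also after the shift (rounded down for [D], up
    for [U]), the ratio errs on the safe side. *)
Lemma emax_lower_spec b n x y k J (l : R) : N.lt 0 y -> l * Nr y = Nr x -> (n <= J)%N ->
  let r := emax_lower b n x y k in N.lt 0 r.2 -> Nr r.1 / Nr r.2 <= emax 5 J l.
Proof.
move=> y0 xy nJ; rewrite /emax_lower.
have yp : 0 < Nr y by have := Nr_lt y0.
have l0 : 0 <= l by rewrite -(pmulr_lge0 _ yp) xy Nr_ge0.
have := @pois_loop_spec (Nr b) l x y n 0%num b b 0%num 0%num y0 (Nr_ge0 _) l0 xy.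
rewrite /= !big_ord0 expr0 fact0 divr1 mulr1 !lexx => /(_ isT isT isT isT).
set r := pois_loop _ _ _ _ _ _ _ _ => -[h1 h2 h3].
set D := N.shiftr r.1 k => D50.
have D0 : 0 < Nr D.
  have D0 : N.lt 0 D by apply/N.neq_0_lt_0 => DE; move: D50; rewrite /= DE.
  by have := Nr_lt D0.
have B0 : N.lt 0 (N.pow 2 k) by apply/N.neq_0_lt_0/N.pow_nonzero.
have Bp : 0 < Nr (N.pow 2 k) by have := Nr_lt B0.
apply: le_trans (emax_leJ 5 l0 nJ).
rewrite ler_pdivrMr; last by have := Nr_lt D50.
rewrite Nr_pow5.
have hF j : (j < n)%N -> pcdf l j.+1 * Nr D <= Nr (N.succ (N.shiftr (nth 0%num r.2 j) k)).
  move=> jn; have := h3 j jn; rewrite -mulr_sumr add0n => H3.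
  rewrite -(ler_pM2r Bp).
  have -> : N.shiftr (nth 0%num r.2 j) k = N.div (nth 0%num r.2 j) (N.pow 2 k).
    exact: N.shiftr_div_pow2.
  apply: le_trans (Nr_div_ge _ B0); apply: le_trans H3.
  have HD : Nr D * Nr (N.pow 2 k) <= Nr b * expR l.
    rewrite /D N.shiftr_div_pow2; apply: le_trans (Nr_div_le _ B0) _.
    apply: le_trans h1 _; rewrite add0n -mulr_sumr ler_wpM2l ?Nr_ge0 //.
    have := pcdf_le1 n l0; rewrite /pcdf /pois -mulr_sumr expRN.
    by rewrite mulrC ler_pdivrMr ?expR_gt0 // mul1r.
  rewrite -mulrA; apply: le_trans (ler_wpM2l (pcdf_ge0 _ l0) HD) _.
  rewrite /pcdf /pois -mulr_sumr expRN.
  set S := \sum_(i < _) _; rewrite [leLHS](_ : _ = Nr b * S) //.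
  by field; rewrite expR_eq0.
apply: le_trans (foldr_sub_pow5 (F := fun j => pcdf l j.+1) _ _) _.
- by move=> j; rewrite pcdf_ge0 ?pcdf_le1.
- by move=> j; rewrite h2; apply: hF.
- by rewrite h2.
Qed.

Lemma point_okP a g n k J : point_ok ((a, g), (n, k)) -> (n <= J)%N ->
  Nr g / 1000 <= emax 5 J ((Nr a / 100) ^+ 2) - (Nr a / 100) ^+ 2.
Proof.
rewrite /point_ok => /andP[/N.ltb_lt r0 /N.leb_le h] nJ.
have E4 : Nr 10000%num = 10000 :> R by rewrite /Nr; congr (_%:R); vm_compute.
have E1 : Nr 10%num = 10 :> R by rewrite /Nr; congr (_%:R); vm_compute.
have xy : (Nr a / 100) ^+ 2 * Nr 10000%num = Nr (N.mul a a) by rewrite E4 Nr_mul; field.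
have := emax_lower_spec (erefl : N.lt 0 10000) xy nJ r0.
move: r0 h; case: (emax_lower _ _ _ _ _) => A B /= /Nr_lt B0 /Nr_le.
rewrite !Nr_mul Nr_add !Nr_mul E4 E1 => h1 h2.
have Bp : 0 < Nr B by [].
apply: (@le_trans _ _ (Nr A / Nr B - (Nr a / 100) ^+ 2)); last by rewrite lerD2r.
rewrite lerBrDr ler_pdivlMr //.
have -> : (Nr a / 100) ^+ 2 = Nr a * Nr a / 10000 by field.
lra.
Qed.

(** Monotonicity gives [(f l - C) / sqrt l >= (gam - C) / q] for [f = emax - l]; adding back
    [C / sqrt l >= C / q'] gives the slope on the whole interval. *)
Lemma emax5_step J (kap q q' gam l : R) : 0 < q -> q <= Num.sqrt l <= q' ->
  (forall x, 0 <= x <= l -> (10 * x + 5 * J%:R) * (1 - pcdf x J) <= 1 / 100) ->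
  gam <= emax 5 J (q ^+ 2) - q ^+ 2 ->
  kap <= (gam - 93 / 100) / q + 93 / 100 / q' ->
  kap * Num.sqrt l <= emax 5 J l - l.
Proof.
move=> q0 /andP[ql lq'] ht hg hk.
have s0 : 0 < Num.sqrt l by apply: lt_le_trans ql.
have l0 : 0 < l by rewrite -sqrtr_gt0.
have q'0 : 0 < q' by apply: lt_le_trans lq'.
(* Seven terms of the series of [e] suffice: [5 / (2 e)] is about 0.9197. *)
have e1 : 5 / 2 * expR (- 1) + 1 / 100 <= 93 / 100 :> R.
  have := pcdf_le1 7 (ler01 : 0 <= 1 :> R).
  rewrite /pcdf /pois -mulr_sumr !big_ord_recr big_ord0 /=.
  rewrite !factS fact0 !expr1n !natrM.
  have := expR_gt0 (- 1 : R); set e := expR _; lra.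
have lE : Num.sqrt l ^+ 2 = l by rewrite sqr_sqrtr // ltW.
have ql2 : q ^+ 2 <= l by rewrite -lE lerXn2r ?nnegrE // ltW.
have := emax5_sqrt_mono (exprn_gt0 2 q0) ql2 ht e1.
rewrite sqrtr_sqr gtr0_norm // => h.
have h2 : (gam - 93 / 100) / q <= (emax 5 J l - l - 93 / 100) / Num.sqrt l.
  by apply: le_trans h; rewrite ler_pM2r ?invr_gt0 // lerD2r.
have h3 : 93 / 100 / q' <= 93 / 100 / Num.sqrt l :> R.
  by rewrite ler_pM2l ?lef_pV2 ?posrE //; lra.
have : kap <= (emax 5 J l - l) / Num.sqrt l.
  apply: le_trans hk _; apply: le_trans (lerD h2 h3) _.
  by rewrite -mulrDl subrK.
by rewrite ler_pdivlMr.
Qed.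

Lemma chain_okP J kap s e (l : R) : chain_ok kap s e ->
  (if s is ((a, _), _) :: _ then Nr a / 100 else Nr e / 100) <= Num.sqrt l <= Nr e / 100 ->
  all (fun t => t.2.1 <= J)%N s -> s != [::] ->
  (forall x, 0 <= x <= l -> (10 * x + 5 * J%:R) * (1 - pcdf x J) <= 1 / 100) ->
  Nr kap / 1000 * Num.sqrt l <= emax 5 J l - l.
Proof.
elim: s => [//|[[a g] [n k]] s IH] /= /and5P[pt /N.ltb_lt/Nr_lt a0 /N.ltb_lt/Nr_lt].
set b := (match s with nil => e | _ => _ end) => b0 /N.leb_le/Nr_le.
have E9 : Nr 93%num = 93 :> R by rewrite /Nr; congr (_%:R); vm_compute.
have E2 : Nr 100%num = 100 :> R by rewrite /Nr; congr (_%:R); vm_compute.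
have E1 : Nr 1000%num = 1000 :> R by rewrite /Nr; congr (_%:R); vm_compute.
rewrite !Nr_add !Nr_mul E9 E1 E2 => st ch /andP[al le] /andP[nJ alls] _ ht.
have ap : 0 < Nr a by []. have bp : 0 < Nr b by [].
case: (lerP (Num.sqrt l) (Nr b / 100)) => lb.
  apply: (@emax5_step J _ (Nr a / 100) (Nr b / 100) (Nr g / 1000)) => //.
  - by rewrite divr_gt0.
  - by rewrite al.
  - exact: point_okP pt nJ.
  - rewrite -(ler_pM2r (mulr_gt0 ap bp)).
    have -> : ((Nr g / 1000 - 93 / 100) / (Nr a / 100) + 93 / 100 / (Nr b / 100)) *
      (Nr a * Nr b) = (Nr g / 10 - 93) * Nr b + 93 * Nr a.
      by field; rewrite !gt_eqF.
    clear -st; lra.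
move: lb; rewrite /b; case: s @b b0 st bp ch alls IH => [|[[b ?] ?] s] _ _ _ _ ch alls IH lb.
  by move: lb; rewrite ltNge le.
by apply: IH; rewrite ?(ltW lb).
Qed.

Lemma emax5_sqrt_bounds (L : R) : 0 <= L -> exists J, forall l, 0 <= l <= L ->
  (55 / 100 <= Num.sqrt l <= 109 / 100 -> 29 / 25 * Num.sqrt l <= emax 5 J l - l) /\
  (109 / 100 <= Num.sqrt l -> 65 / 58 * Num.sqrt l <= emax 5 J l - l).
Proof.
move=> L0; have c0 : 0 < 1 / 100 :> R by lra.
have [J0 HJ] := pcdf_tail_small L0 c0.
(* 572 is the largest number of terms among the certified points; [J0] makes the tail error at most
   [1 / 100] on [[0, L]], which is why [J] depends on [L]. *)
exists (maxn 572 J0) => l /andP[l0 lL].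
set J := maxn _ _; have JJ : (J0 <= J)%N by apply: leq_maxr.
have ht x : 0 <= x <= l -> (10 * x + 5 * J%:R) * (1 - pcdf x J) <= 1 / 100.
  by move=> /andP[x0 xl]; apply: HJ => //; rewrite x0 (le_trans xl).
have J5 : (572 <= J)%N by apply: leq_maxl.
have E k n : N.to_nat k = n -> Nr k = n%:R by rewrite /Nr => ->.
have E1 : Nr 55%num = 55 by apply: E; vm_compute.
have E2 : Nr 109%num = 109 by apply: E; vm_compute.
have E3 : 29 / 25 <= Nr 1160%num / 1000 :> R.
  by rewrite (_ : Nr 1160%num = 116 * 10) ?(E _ _ erefl) -?natrM //; lra.
have E4 : 65 / 58 <= Nr 1121%num / 1000 :> R.
  by rewrite (_ : Nr 1121%num = 11 * 100 + 21) ?(E _ _ erefl) -?natrM -?natrD //; lra.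
have E5 : Nr 2000%num / 100 = 20 :> R.
  by rewrite (_ : Nr 2000%num = 20 * 100) ?mulfK // (E _ _ erefl) -natrM.
have E6 : Nr 23388%num / 1000 = 23 + 388 / 1000 :> R.
  have -> : 23388%num = N.add (N.mul 23 1000) 388 by [].
  rewrite Nr_add Nr_mul (E 23%num 23%N erefl) (E 388%num 388%N erefl).
  rewrite (E 1000%num 1000%N erefl) mulrDl mulfK ?pnatr_eq0 //.
have sm s : all (fun t : (N * N) * (nat * N) => t.2.1 <= 572)%N s ->
    all (fun t : (N * N) * (nat * N) => t.2.1 <= J)%N s.
  by apply: sub_all => t /leq_trans; apply.
have as1 : all (fun t : (N * N) * (nat * N) => t.2.1 <= 572)%N points_small by vm_compute.
have as2 : all (fun t : (N * N) * (nat * N) => t.2.1 <= 572)%N points_large by vm_compute.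
have wk (a b c : R) : 0 <= l -> a <= b -> b * Num.sqrt l <= c -> a * Num.sqrt l <= c.
  by move=> _ ab; apply: le_trans; rewrite ler_wpM2r ?sqrtr_ge0.
split=> [lq|lq].
  apply: wk E3 _ => //; apply: chain_okP points_small_ok _ (sm _ as1) isT ht.
  by rewrite /= E1 E2.
case: (lerP (Num.sqrt l) 20) => l20.
  apply: wk E4 _ => //; apply: chain_okP points_large_ok _ (sm _ as2) isT ht.
  by rewrite /= E2 E5 lq l20.
have := point_okP point_last_ok J5; rewrite E5 E6.
have s0 : 0 < Num.sqrt l by apply: lt_trans l20.
clear -s0 l20 ht => hp; apply: (emax5_step (q' := Num.sqrt l) _ _ ht hp) => //.
  by rewrite lexx andbT ltW.
have : 0 <= 93 / 100 / Num.sqrt l by rewrite divr_ge0 ?ltW //; lra.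
lra.
Qed.
End Certificate.

(** * The limiting modularity *)

Section Integral.
Variable R : realType.

(* For nondecreasing [f] this implies [I <= \int_a^b f]; bounding the increments of
   [Psi] by right-endpoint rectangles is all that is needed to compare with Riemann
   sums, and avoids any integration theory. *)
Definition integral_ge (f : R -> R) (a b I : R) : Prop :=
  exists2 Psi : R -> R, (forall x y, a <= x -> x <= y -> y <= b ->
    Psi y - Psi x <= (y - x) * f y) & Psi b - Psi a = I.

Lemma integral_ge_cat f (a b d I I' : R) :
  (forall x y, a <= x -> x <= y -> y <= d -> f x <= f y) -> a <= b -> b <= d ->
  integral_ge f a b I -> integral_ge f b d I' -> integral_ge f a d (I + I').
Proof.
move=> fm ab bd [P1 h1 e1] [P2 h2 e2].
exists (fun x => P1 (Num.min x b) + P2 (Num.max x b)); last first.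
  rewrite (min_r bd) (max_l bd) (min_l ab) (max_r ab); lra.
move=> x y ax xy yd; case: (lerP y b) => yb.
  rewrite (min_l (le_trans xy yb)) (max_r (le_trans xy yb)).
  by have := h1 x y ax xy yb; lra.
case: (lerP x b) => xb; last first.
  by have := h2 x y (ltW xb) xy yd; lra.
have A := h1 x b ax xb (lexx b); have B := h2 b y (lexx b) (ltW yb) yd.
have F : (b - x) * f b <= (b - x) * f y.
  by rewrite ler_wpM2l ?subr_ge0 ?fm // ltW.
lra.
Qed.

Lemma integral_ge_mono f g (a b I : R) :
  (forall x, a <= x -> x <= b -> f x <= g x) ->
  integral_ge f a b I -> integral_ge g a b I.
Proof.
move=> fg [P h e]; exists P => // x y ax xy yb.
apply: le_trans (h x y ax xy yb) _.
by rewrite ler_wpM2l ?subr_ge0 // fg // (le_trans ax).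
Qed.

Lemma integral_exp k (a b : R) : integral_ge (fun l => 1 - expR (- (k.+1%:R * l))) a b
  (b - a - (expR (- (k.+1%:R * a)) - expR (- (k.+1%:R * b))) / k.+1%:R).
Proof.
set n : R := k.+1%:R; have n0 : 0 < n by rewrite ltr0Sn.
exists (fun l => l + expR (- (n * l)) / n); last by field; rewrite gt_eqF.
move=> x y _ xy _; rewrite -subr_ge0.
have -> : (y - x) * (1 - expR (- (n * y))) - (y + expR (- (n * y)) / n - (x + expR (- (n * x)) / n))
  = (expR (- (n * x)) - expR (- (n * y)) * (1 + (n * y - n * x))) / n.
  by field; rewrite gt_eqF.
apply: divr_ge0; last exact: ltW.
rewrite subr_ge0.
apply: (@le_trans _ _ (expR (- (n * y)) * expR (n * y - n * x))).
  by rewrite ler_wpM2l ?expR_ge0 // expR_ge1Dx.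
by rewrite -expRD (_ : _ + _ = - (n * x)) //; ring.
Qed.

Lemma integral_sqrt (K a b : R) : 0 <= K -> 0 <= a -> a <= b ->
  integral_ge (fun l => l + K * Num.sqrt l) a b
  ((b ^+ 2 - a ^+ 2) / 2 + 2 / 3 * K * (Num.sqrt b ^+ 3 - Num.sqrt a ^+ 3)).
Proof.
move=> K0 a0 ab; exists (fun l => l ^+ 2 / 2 + 2 / 3 * K * Num.sqrt l ^+ 3); last by lra.
move=> x y ax xy _.
have x0 : 0 <= x by apply: le_trans ax.
have y0 : 0 <= y by apply: le_trans xy.
have uv : Num.sqrt x <= Num.sqrt y by rewrite ler_sqrt.
have u0 := sqrtr_ge0 x; have := sqr_sqrtr x0; have := sqr_sqrtr y0.
move: (Num.sqrt x : R) (Num.sqrt y : R) u0 uv => u v u0 uv <- <-.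
have t1 : 0 <= K * ((v - u) ^+ 2 * (v + 2 * u)).
  by apply: mulr_ge0 => //; apply: mulr_ge0; [exact: sqr_ge0 | lra].
have t2 : 0 <= (v ^+ 2 - u ^+ 2) ^+ 2 by apply: sqr_ge0.
rewrite -subr_ge0 (_ : _ - _ = (v ^+ 2 - u ^+ 2) ^+ 2 / 2 +
  K * ((v - u) ^+ 2 * (v + 2 * u)) / 3); last by field.
by rewrite addr_ge0 ?divr_ge0.
Qed.

Lemma emax1E k (l : R) : emax k 1 l = 1 - expR (- (k%:R * l)).
Proof.
by rewrite /emax big_ord1 pcdfS pcdf0 add0r /pois expr0 fact0 divr1 mulr1 -expRM_natl mulrN.
Qed.

Lemma expR_ge_pow n (x : R) : 0 <= 1 + x / n.+1%:R -> (1 + x / n.+1%:R) ^+ n.+1 <= expR x.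
Proof.
move=> h; rewrite -[in leRHS](divfK (_ : n.+1%:R != 0 :> R) x) ?pnatr_eq0 // expRM_natr.
by rewrite lerXn2r ?nnegrE ?expR_ge0 // expR_ge1Dx.
Qed.

(** The right side is the limit of the bound as [K] grows, when [emax] is truncated at [J = 1]. In
    terms of [s = sqrt c] the claim becomes a cubic inequality on [[1, sqrt 6]]. *)
Lemma small_density (c : R) : 1 <= c -> c <= 6 ->
  668 / 1000 / Num.sqrt c < 2 / c * (1 - (1 - expR (- c)) / c).
Proof.
move=> c1 c6; have c0 : 0 < c by lra.
have s0 : 0 < Num.sqrt c by rewrite sqrtr_gt0.
have sc : Num.sqrt c ^+ 2 = c by rewrite sqr_sqrtr // ltW.
have e0 : 343 / 1000 <= expR (- 1) :> R.
  by apply: le_trans (expR_ge_pow (n := 7) _); lra.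
(* The tangent of [e^-c] at [c = 1], trivial beyond [c = 2]; hence the later split near
   [s = sqrt 2]. *)
have e1 : 343 / 1000 * (2 - c) <= expR (- c).
  case: (lerP c 2) => c2; last by apply: le_trans (expR_ge0 _); nra.
  have -> : - c = - 1 + (1 - c) by ring.
  rewrite expRD; apply: ler_pM; [lra|lra|by []|].
  by have := expR_ge1Dx (1 - c); lra.
have e2 := expR_ge0 (- c).
suff : 334 / 1000 * Num.sqrt c * c < c - 1 + expR (- c).
  move=> h; rewrite -subr_gt0.
  have -> : 2 / c * (1 - (1 - expR (- c)) / c) - 668 / 1000 / Num.sqrt c =
    2 / c ^+ 2 * (c - 1 + expR (- c) - 334 / 1000 * Num.sqrt c * c).
    move: (expR (- c)) (Num.sqrt c : R) s0 sc => e s s0 <-.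
    by field; rewrite gt_eqF.
  apply: mulr_gt0; last by rewrite subr_gt0.
  by apply: divr_gt0; [lra | apply: exprn_gt0].
have s1 : 1 <= Num.sqrt c by nra.
move: (Num.sqrt c : R) s0 sc s1 e1 => s s0 sc s1 e1.
rewrite -sc in e1 e2 c1 c6 *.
have : s <= 245 / 100 by rewrite leNgt; apply/negP => h; nra.
move=> s245; case: (lerP s (142 / 100)) => h.
  have : 0 <= (s - 1) * (142 / 100 - s) by rewrite mulr_ge0 ?subr_ge0.
  nra.
have q : 0 <= (s - 142 / 100) * (245 / 100 - s) by apply: mulr_ge0; lra.
have := mulr_ge0 (ltW s0) q; lra.
Qed.

Lemma integral_emax_small (c : R) : 1 <= c -> c <= 6 ->
  exists k I, integral_ge (emax k.+1 1) 0 (c / k.+1%:R) I /\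
    668 / 1000 / Num.sqrt c < 2 * k.+1%:R / c ^+ 2 * I - k.+1%:R^-1.
Proof.
move=> c1 c6; have h := small_density c1 c6.
have c0 : 0 < c by lra.
(* [K] is taken large enough for the penalty [1 / K] to fit in the gap left by [small_density]. *)
have [k hk] : exists k, k.+1%:R^-1 < 2 / c * (1 - (1 - expR (- c)) / c)
    - 668 / 1000 / Num.sqrt c.
  set e := _ - _; have e0 : 0 < e by rewrite subr_gt0.
  exists (Num.truncn e^-1); rewrite invf_plt ?posrE //.
  exact: truncnS_gt.
exists k, (c / k.+1%:R - (1 - expR (- c)) / k.+1%:R); split.
  have := @integral_exp k 0 (c / k.+1%:R).
  rewrite subr0 mulr0 oppr0 expR0 [k.+1%:R * _]mulrC divfK ?pnatr_eq0 //.
  by apply: integral_ge_mono => x _ _; rewrite emax1E.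
have -> : 2 * k.+1%:R / c ^+ 2 * (c / k.+1%:R - (1 - expR (- c)) / k.+1%:R) =
   2 / c * (1 - (1 - expR (- c)) / c).
  by field; rewrite nat1r pnatr_eq0 gt_eqF.
by rewrite ltrBrDr -ltrBrDl.
Qed.

Lemma integral_emax_large (c : R) : 6 <= c ->
  exists J I, integral_ge (emax 5 J) 0 (c / 5) I /\
    668 / 1000 / Num.sqrt c < 2 * 5 / c ^+ 2 * I - 5^-1.
Proof.
move=> c6; set L := c / 5.
have L12 : 12 / 10 <= L by rewrite /L; lra.
have L0 : 0 <= L by lra.
have [J HJ] := emax5_sqrt_bounds L0.
(* Breakpoints for [sqrt l]. Below [q0] only the probability of a positive maximum is used; [q1]
   must satisfy [q1^2 <= 6 / 5], the least value of [L]. *)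
pose q0 : R := 55 / 100; pose q1 : R := 109 / 100.
have q00 : 0 <= q0 by rewrite /q0; lra.
have q01 : q0 <= q1 by rewrite /q0 /q1; lra.
have q10 : 0 <= q1 by apply: le_trans q01.
have x01 : q0 ^+ 2 <= q1 ^+ 2 by rewrite lerXn2r.
have x1L : q1 ^+ 2 <= L by apply: le_trans L12; rewrite /q1; lra.
have sq (q : R) : 0 <= q -> Num.sqrt (q ^+ 2) = q by move=> h; rewrite sqrtr_sqr ger0_norm.
have mono x y : 0 <= x -> x <= y -> y <= L -> emax 5 J.+1 x <= emax 5 J.+1 y.
  by move=> x0 xy _; apply: emax_le; rewrite x0 xy.
have I1 : integral_ge (emax 5 J.+1) 0 (q0 ^+ 2)
    (q0 ^+ 2 - 0 - (expR (- (4.+1%:R * 0)) - expR (- (4.+1%:R * q0 ^+ 2))) / 4.+1%:R).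
  apply: integral_ge_mono (@integral_exp 4 0 (q0 ^+ 2)) => x x0 _.
  by rewrite -emax1E emax_leJ.
have I2 : integral_ge (emax 5 J.+1) (q0 ^+ 2) (q1 ^+ 2)
    ((q1 ^+ 2 ^+ 2 - q0 ^+ 2 ^+ 2) / 2 + 2 / 3 * (29 / 25) * (q1 ^+ 3 - q0 ^+ 3)).
  have := @integral_sqrt (29 / 25) _ _ _ (sqr_ge0 q0) x01.
  rewrite !sq // => /(_ ltac:(lra)); apply: integral_ge_mono => x ax xb.
  have x0 : 0 <= x by apply: le_trans ax; apply: sqr_ge0.
  have [|+ _] := HJ x; first by rewrite x0 (le_trans xb).
  have -> : 55 / 100 <= Num.sqrt x by rewrite -[leLHS](sq _ q00) ler_wsqrtr.
  have -> : Num.sqrt x <= 109 / 100 by rewrite -[leRHS](sq _ q10) ler_wsqrtr.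
  move=> /(_ isT).
  have := emax_leJ 5 x0 (leqnSn J); lra.
have I3 : integral_ge (emax 5 J.+1) (q1 ^+ 2) L
    ((L ^+ 2 - q1 ^+ 2 ^+ 2) / 2 + 2 / 3 * (65 / 58) * (Num.sqrt L ^+ 3 - q1 ^+ 3)).
  have := @integral_sqrt (65 / 58) _ _ _ (sqr_ge0 q1) x1L.
  rewrite !sq // => /(_ ltac:(lra)); apply: integral_ge_mono => x ax xb.
  have x0 : 0 <= x by apply: le_trans ax; apply: sqr_ge0.
  have [|_ +] := HJ x; first by rewrite x0.
  have -> : 109 / 100 <= Num.sqrt x by rewrite -[leLHS](sq _ q10) ler_wsqrtr.
  move=> /(_ isT).
  have := emax_leJ 5 x0 (leqnSn J); lra.
exists J.+1; eexists; split.
  apply: integral_ge_cat I3 => //; first exact: sqr_ge0.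
  apply: (integral_ge_cat _ _ _ I1 I2) => //; last exact: sqr_ge0.
  by move=> x y x0 xy yq; apply: mono => //; apply: le_trans x1L.
rewrite mulr0 oppr0 expR0; set e := expR _.
have he : 1 / 5 <= e.
  apply: le_trans (expR_ge_pow (n := 15) _); last by rewrite /q0; lra.
  set a : R := 1 + _; have ha : 905 / 1000 <= a by rewrite /a /q0; lra.
  have -> : a ^+ 16 = (((a ^+ 2) ^+ 2) ^+ 2) ^+ 2 by rewrite -!exprM.
  have a2 : 819 / 1000 <= a ^+ 2 by nra.
  have a4 : 67 / 100 <= (a ^+ 2) ^+ 2 by nra.
  have a8 : 448 / 1000 <= ((a ^+ 2) ^+ 2) ^+ 2 by nra.
  nra.
have cE : c = 5 * L by rewrite /L; lra.
have Lp : 0 < L by lra.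
have s0 : 0 < Num.sqrt L by rewrite sqrtr_gt0.
have sL : Num.sqrt L ^+ 2 = L by rewrite sqr_sqrtr.
have t0 : 0 < Num.sqrt c by rewrite sqrtr_gt0; lra.
have tc : Num.sqrt c ^+ 2 = 5 * Num.sqrt L ^+ 2 by rewrite sL -cE sqr_sqrtr //; lra.
move: (Num.sqrt c : R) (Num.sqrt L : R) t0 s0 sL tc => t S t0 s0 sL tc.
rewrite [c in c ^+ 2]cE -sL.
(* [161 / 72] is a continued fraction convergent of [sqrt 5], from above. *)
have tS : t <= 161 / 72 * S.
  rewrite leNgt; apply/negP => h; nra.
set I := (X in _ < 2 * 5 / _ * X - _).
(* The terms in [S^3] compare because [2/3 * 65/58 > 167/500 * 161/72], with little room. The
   constants of the three pieces leave about 0.002; the steeper slope [29 / 25] on the middle piece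
   keeps this positive. *)
have key : 167 / 500 * t * S ^+ 2 < I - S ^+ 4 / 2.
  apply: (@le_lt_trans _ _ (167 / 500 * (161 / 72 * S) * S ^+ 2)).
    have := ler_wpM2r (exprn_ge0 2 (ltW s0)) tS; lra.
  rewrite /I /q0 /q1; have := exprn_gt0 3 s0; clear -he; lra.
have S4 : 0 < S ^+ 4 := exprn_gt0 4 s0.
clearbody I; clear -key S4 t0 s0 tc.
have -> : 668 / 1000 / t = 668 / 1000 * t / (5 * S ^+ 2).
  by rewrite -tc; field; rewrite gt_eqF.
rewrite -(ltr_pM2r S4).
have -> : 668 / 1000 * t / (5 * S ^+ 2) * S ^+ 4 = 2 / 5 * (167 / 500 * t * S ^+ 2).
  by field; rewrite gt_eqF.
have -> : (2 * 5 / (5 * S ^+ 2) ^+ 2 * I - 5^-1) * S ^+ 4 = 2 / 5 * (I - S ^+ 4 / 2).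
  by field; rewrite gt_eqF.
lra.
Qed.
End Integral.

(** * Finite product spaces *)

Section Expectation.
Variables (R : realType) (I T : finType) (w : T -> R).
Implicit Types (f g : {ffun I -> T} -> R) (x : {ffun I -> T}).

Definition Ex f : R := \sum_(x : {ffun I -> T}) (\prod_i w (x i)) * f x.

Definition upd x (i : I) (t : T) : {ffun I -> T} := [ffun j => if j == i then t else x j].

Lemma Ex_ext f g : f =1 g -> Ex f = Ex g.
Proof. by move=> fg; apply: eq_bigr => x _; rewrite fg. Qed.

Lemma Ex_add f g : Ex (fun x => f x + g x) = Ex f + Ex g.
Proof. by rewrite /Ex -big_split; apply: eq_bigr => x _; rewrite mulrDr. Qed.

Lemma Ex_scale (a : R) f : Ex (fun x => a * f x) = a * Ex f.
Proof. by rewrite /Ex mulr_sumr; apply: eq_bigr => x _; rewrite mulrCA. Qed.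

Lemma Ex_opp f : Ex (fun x => - f x) = - Ex f.
Proof. by rewrite -mulN1r -Ex_scale; apply: Ex_ext => x; rewrite mulN1r. Qed.

Lemma Ex_sub f g : Ex (fun x => f x - g x) = Ex f - Ex g.
Proof. by rewrite Ex_add Ex_opp. Qed.

Lemma Ex_sum (K : finType) (P : pred K) (F : K -> {ffun I -> T} -> R) :
  Ex (fun x => \sum_(j | P j) F j x) = \sum_(j | P j) Ex (F j).
Proof. by rewrite /Ex exchange_big; apply: eq_bigr => x _; rewrite mulr_sumr. Qed.

Hypothesis w0 : forall t, 0 <= w t.
Hypothesis w1 : \sum_t w t = 1.

Lemma Ex_const (c : R) : Ex (fun=> c) = c.
Proof.
rewrite /Ex -mulr_suml -(bigA_distr_bigA (fun (i : I) t => w t)).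
by rewrite big1 ?mul1r.
Qed.

Lemma Ex_le f g : (forall x, f x <= g x) -> Ex f <= Ex g.
Proof. by move=> fg; apply: ler_sum => x _; rewrite ler_wpM2l ?prodr_ge0. Qed.

Lemma Ex_ge0 f : (forall x, 0 <= f x) -> 0 <= Ex f.
Proof. by move=> f0; rewrite -(Ex_const 0) Ex_le. Qed.

Lemma updE x i t : upd x i t i = t. Proof. by rewrite ffunE eqxx. Qed.

Lemma upd_neq x i t j : j != i -> upd x i t j = x j.
Proof. by rewrite ffunE => /negPf ->. Qed.

Lemma upd_upd x i t t' : upd (upd x i t) i t' = upd x i t'.
Proof. by apply/ffunP => j; rewrite !ffunE; case: eqP. Qed.

Lemma upd_id x i : upd x i (x i) = x.
Proof. by apply/ffunP => j; rewrite ffunE; case: eqP => // ->. Qed.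

(** Only coordinate [i] is averaged and all others are frozen. For a function of the coordinates up
    to [i] this is the conditional expectation given the past. *)
Definition cond (i : I) f x : R := \sum_t w t * f (upd x i t).

(** Coordinate [i] and an independent copy [t] are swapped by a weight-preserving involution. *)
Lemma Ex_cond i f : Ex f = Ex (cond i f).
Proof.
pose h (q : {ffun I -> T} * T) := (upd q.1 i q.2, q.1 i).
have hK : involutive h by move=> [x t]; rewrite /h /= upd_upd upd_id updE.
have W x t : (\prod_j w (x j)) * w t = (\prod_j w (upd x i t j)) * w (x i).
  rewrite (bigD1 i) //= [in RHS](bigD1 i) //= updE mulrAC [RHS]mulrAC; congr (_ * _).
    by rewrite mulrC.
  by apply: eq_bigr => j ji; rewrite upd_neq.
transitivity (\sum_(q : {ffun I -> T} * T) (\prod_j w (q.1 j)) * w q.2 * f q.1).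
  rewrite -(pair_bigA _ (fun x t => (\prod_j w (x j)) * w t * f x)) /=.
  by apply: eq_bigr => x _; rewrite -mulr_suml -mulr_sumr w1 mulr1.
rewrite (reindex_inj (inv_inj hK)) /=.
transitivity (\sum_(q : {ffun I -> T} * T) (\prod_j w (q.1 j)) * w q.2 * f (upd q.1 i q.2)).
  by apply: eq_bigr => -[x t] _ /=; rewrite -W.
rewrite -(pair_bigA _ (fun x t => (\prod_j w (x j)) * w t * f (upd x i t))) /=.
by apply: eq_bigr => x _; rewrite /cond mulr_sumr; apply: eq_bigr => t _; rewrite mulrA.
Qed.

Lemma Ex_markov f (a : R) : (forall x, 0 <= f x) -> 0 < a ->
  Ex (fun x => (a <= f x)%R%:R) <= Ex f / a.
Proof.
move=> f0 a0; rewrite mulrC -Ex_scale; apply: Ex_le => x.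
case: (lerP a (f x)) => h /=; last by rewrite mulr_ge0 ?invr_ge0 // ltW.
by rewrite mulrC ler_pdivlMr ?mul1r.
Qed.

Lemma Ex_chebyshev f (a : R) : 0 < a ->
  Ex (fun x => (a <= `|f x|)%R%:R) <= Ex (fun x => f x ^+ 2) / a ^+ 2.
Proof.
move=> a0; apply: le_trans (Ex_markov (fun x => sqr_ge0 (f x)) (exprn_gt0 2 a0)).
apply: Ex_le => x; rewrite ler_nat -(real_normK (num_real (f x))).
by case: (lerP a `|f x|) => // h; rewrite (lerXn2r 2) ?nnegrE ?(ltW a0) //.
Qed.

(** Pointwise [|f| <= f^2 / (2 a) + a / 2], which replaces Cauchy-Schwarz. *)
Lemma Ex_norm_le f (a b : R) : 0 < a -> Ex (fun x => f x ^+ 2) <= b * a ^+ 2 ->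
  Ex (fun x => `|f x|) <= (b + 1) / 2 * a.
Proof.
move=> a0 h.
apply: (@le_trans _ _ (Ex (fun x => (2 * a)^-1 * f x ^+ 2 + a / 2))).
  apply: Ex_le => x; rewrite -(real_normK (num_real (f x))).
  rewrite -subr_ge0 (_ : _ - _ = (`|f x| - a) ^+ 2 / (2 * a)); last by field; rewrite gt_eqF.
  by rewrite divr_ge0 ?sqr_ge0 // mulr_ge0 // ltW.
rewrite Ex_add Ex_const Ex_scale.
have -> : (b + 1) / 2 * a = (2 * a)^-1 * (b * a ^+ 2) + a / 2 by field; rewrite gt_eqF.
by rewrite lerD2r ler_wpM2l // invr_ge0 mulr_ge0 // ltW.
Qed.
End Expectation.
Arguments Ex_const {R} I {T w}.

(** * Orthogonality of martingale increments *)

Section Martingale.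
Variables (R : realType) (n : nat) (T : finType) (w : T -> R).
Hypothesis w0 : forall t, 0 <= w t.
Hypothesis w1 : \sum_t w t = 1.
Local Notation Om := {ffun 'I_n -> T}.

Definition adapted (v : 'I_n) (f : Om -> R) : Prop :=
  forall x y : Om, (forall u : 'I_n, (u <= v)%N -> x u = y u) -> f x = f y.

(** For [v < u], averaging over coordinate [u] leaves the earlier increment unchanged and kills the
    later one, so cross terms vanish. A diagonal term is a conditional variance, at most the second
    moment. *)
Lemma Ex_martingale (X : 'I_n -> Om -> R) (B : R) :
  (forall v, adapted v (X v)) ->
  (forall v x, cond w v (fun y => X v y ^+ 2) x <= B) ->
  Ex w (fun x => (\sum_v (X v x - cond w v (X v) x)) ^+ 2) <= n%:R * B.
Proof.
move=> Xad XB; pose D v x := X v x - cond w v (X v) x.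
have Dupd (v u : 'I_n) x t : (v < u)%N -> D v (upd x u t) = D v x.
  move=> vu; rewrite /D; congr (_ - _).
    by apply: Xad => z zv; rewrite upd_neq // -(inj_eq val_inj) ltn_eqF // (leq_ltn_trans zv).
  rewrite /cond; apply: eq_bigr => s _; congr (_ * _).
  apply: Xad => z zv; rewrite !ffunE; case: eqP => // _.
  by case: eqP => // zu; move: vu; rewrite -zu ltnNge zv.
have condD v x : cond w v (D v) x = 0.
  rewrite /cond /D; under eq_bigr do rewrite mulrBr.
  rewrite sumrB; apply/eqP; rewrite subr_eq0; apply/eqP.
  transitivity (\sum_t w t * cond w v (X v) x); first by rewrite -mulr_suml w1 mul1r.
  apply: eq_bigr => t _; congr (_ * _); rewrite /cond.
  by apply: eq_bigr => s _; rewrite upd_upd.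
have orth (v u : 'I_n) : (v < u)%N -> Ex w (fun x => D v x * D u x) = 0.
  move=> vu; rewrite (Ex_cond w1 u) -[RHS](Ex_const 'I_n w1 0); apply: Ex_ext => x.
  transitivity (D v x * cond w u (D u) x); last by rewrite condD mulr0.
  rewrite /cond mulr_sumr; apply: eq_bigr => t _; rewrite Dupd //; ring.
have diag v : Ex w (fun x => D v x * D v x) <= B.
  rewrite (Ex_cond w1 v) -[leRHS](Ex_const 'I_n w1 B); apply: Ex_le => x //.
  apply: le_trans (XB v x).
  set m := cond w v (X v) x.
  have -> : cond w v (fun y => D v y * D v y) x =
      cond w v (fun y => X v y ^+ 2) x - m ^+ 2.
    rewrite /cond [X in X - _](_ : _ = \sum_t w t * (X v (upd x v t) - m) ^+ 2
       + 2 * m * \sum_t w t * X v (upd x v t) - m ^+ 2 * \sum_t w t).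
      rewrite w1 -/(cond w v (X v) x) -/m mulr1 -!addrA [X in _ = _ + X](_ : _ = 0); last by ring.
      rewrite addr0; apply: eq_bigr => t _; rewrite /D expr2.
      have -> : cond w v (X v) (upd x v t) = m by apply: eq_bigr => s _; rewrite upd_upd.
      by [].
    clearbody m; rewrite !mulr_sumr -big_split -sumrB /=.
    by apply: eq_bigr => t _; ring.
  by rewrite gerBl sqr_ge0.
have -> : Ex w (fun x => (\sum_v D v x) ^+ 2) = \sum_v \sum_u Ex w (fun x => D v x * D u x).
  under eq_bigr do rewrite -Ex_sum; rewrite -Ex_sum; apply: Ex_ext => x.
  by rewrite expr2 mulr_suml; apply: eq_bigr => v _; rewrite mulr_sumr.
have -> : n%:R * B = \sum_(v < n) B by rewrite sumr_const card_ord mulr_natl.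
apply: ler_sum => v _; rewrite (bigD1 v) //= big1 ?addr0 //.
move=> u uv; have := uv; rewrite -(inj_eq val_inj) /= neq_ltn => /orP[lt|lt]; last exact: orth.
by rewrite -[RHS](orth u v lt); apply: Ex_ext => x; rewrite mulrC.
Qed.
End Martingale.

Section Product.
Variables (R : realType) (T : finType) (w : T -> R).
Hypothesis w1 : \sum_t w t = 1.

(** The coordinates outside the range of [th] sum to total weight 1; injectivity keeps those read by
    [th] independent. *)
Lemma Ex_marginal (I A : finType) (th : A -> I) (g : {ffun A -> T} -> R) :
  injective th ->
  Ex w (fun e : {ffun I -> T} => g [ffun a => e (th a)]) = Ex w g.
Proof.
move=> thI; rewrite /Ex (partition_big (fun e : {ffun I -> T} => [ffun a => e (th a)]) predT) //=.
apply: eq_bigr => x _.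
transitivity ((\sum_(e : {ffun I -> T} | [ffun a => e (th a)] == x) \prod_i w (e i)) * g x).
  by rewrite mulr_suml; apply: eq_bigr => e /eqP ->.
congr (_ * _).
pose F (i : I) : pred T := [pred t | [forall a, (th a == i) ==> (t == x a)]].
rewrite (eq_bigl (fun e => e \in family F)); last first.
  move=> e /=; apply/eqP/familyP => [xE i|h].
    by rewrite inE; apply/forallP => a; apply/implyP => /eqP <-; rewrite -xE ffunE.
  apply/ffunP => a; rewrite ffunE; have := h (th a); rewrite inE.
  by move=> /forallP /(_ a); rewrite eqxx => /eqP.
rewrite -(bigA_distr_big_dep F (fun (i : I) t => w t)).
rewrite (bigID (mem (finset.imset th (mem predT)))) /= [X in _ * X]big1 ?mulr1; last first.
  move=> i /negP iN; rewrite -[RHS]w1; apply: eq_bigl => t; rewrite /F /=.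
  by apply/forallP => a; apply/implyP => /eqP E; case: iN; rewrite -E imset_f.
rewrite big_imset /=; last by move=> a b _ _; apply: thI.
apply: eq_bigr => a _; rewrite (big_pred1 (x a)) // => t; rewrite /F /=.
apply/forallP/eqP => [/(_ a)|-> b]; first by rewrite eqxx => /eqP.
by apply/implyP => /eqP /thI ->.
Qed.

Lemma Ex_prod (K J : finType) (h : K -> {ffun J -> T} -> R) :
  Ex w (fun x : {ffun K * J -> T} => \prod_i h i [ffun j => x (i, j)]) = \prod_i Ex w (h i).
Proof.
rewrite /Ex (bigA_distr_bigA (fun i (x : {ffun J -> T}) => (\prod_j w (x j)) * h i x)).
pose unc (y : {ffun K -> {ffun J -> T}}) : {ffun K * J -> T} := [ffun a => y a.1 a.2].
rewrite (reindex unc); last first.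
  exists (fun x : {ffun K * J -> T} => [ffun i => [ffun j => x (i, j)]]) => y _.
    by apply/ffunP => i; apply/ffunP => j; rewrite !ffunE.
  by apply/ffunP => -[i j]; rewrite !ffunE.
apply: eq_bigr => y _; rewrite big_split /=; congr (_ * _).
  rewrite pair_bigA /=; apply: eq_bigr => -[i j] _; by rewrite ffunE.
by apply: eq_bigr => i _; congr (h i _); apply/ffunP => j; rewrite !ffunE.
Qed.

End Product.

(** * Binomial counts compared with Poisson variables *)

Section Bernoulli.
Variables (R : realType) (p : R).
Hypothesis p01 : 0 <= p <= 1.

Definition bern (b : bool) : R := if b then p else 1 - p.

Lemma bern_ge0 b : 0 <= bern b.
Proof. by case/andP: p01 => p0 p1; case: b; rewrite /= ?subr_ge0. Qed.

Lemma bern_sum : \sum_b bern b = 1.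
Proof. by rewrite big_bool /= addrC subrK. Qed.

Lemma ffact_le n m : (n ^_ m <= n ^ m)%N.
Proof.
elim: m n => [|m IH] n; first by rewrite ffactn0.
case: n => [|n]; first by rewrite ffact0n.
rewrite ffactSS expnS leq_mul2l /=.
apply: leq_trans (IH n) _; case: (m) => [|m']; first by rewrite !expn0.
by rewrite leq_exp2r.
Qed.

Lemma binomial_pmf r i :
  Ex bern (fun y : {ffun 'I_r -> bool} => ((\sum_j y j)%N == i)%:R) =
  'C(r, i)%:R * (p ^+ i * (1 - p) ^+ (r - i)).
Proof.
pose f (A : {set 'I_r}) : {ffun 'I_r -> bool} := [ffun j => j \in A].
rewrite /Ex (reindex f); last first.
  exists (fun y : {ffun 'I_r -> bool} => finset y) => [A|y] _; first by apply/setP => j; rewrite inE ffunE.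
  by apply/ffunP => j; rewrite ffunE inE.
have cf A : (\sum_j f A j)%N = #|A|.
  by rewrite -sum1_card [RHS]big_mkcond; apply: eq_bigr => j _; rewrite ffunE; case: (j \in A).
transitivity (\sum_(A : {set 'I_r} | #|A| == i) p ^+ i * (1 - p) ^+ (r - i)).
  rewrite [RHS]big_mkcond; apply: eq_bigr => A _; rewrite cf.
  case: eqP => [Ai|_]; last by rewrite mulr0.
  rewrite mulr1 (bigID (mem A)) /=; congr (_ * _).
    rewrite (eq_bigr (fun=> p)) => [|j jA]; first by rewrite prodr_const Ai.
    by rewrite ffunE jA.
  rewrite (eq_bigr (fun=> 1 - p)) => [|j jA]; last by rewrite ffunE (negPf jA).
  rewrite prodr_const; congr (_ ^+ _).
  by rewrite -Ai -[X in (X - _)%N](card_ord r) -(cardC (mem A)) addKn.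
rewrite sumr_const -[LHS]mulr_natl; congr (_ * _); congr (_%:R).
by rewrite -[in RHS](card_ord r) -card_draws cardsE.
Qed.

(** Only upper bounds on point masses matter, because [emax] decreases in the distribution function.
    For bounded [i] the factor [e^(p i)] tends to 1 with [p], so no total variation estimate
    enters. *)
Lemma binomial_pmf_le r i :
  Ex bern (fun y : {ffun 'I_r -> bool} => ((\sum_j y j)%N == i)%:R) <=
  expR (p * i%:R) * pois (p * r%:R) i.
Proof.
have /andP[p0 p1] := p01; rewrite binomial_pmf.
case: (ltnP r i) => ir.
  by rewrite bin_small // mul0r mulr_ge0 ?expR_ge0 ?pois_ge0 ?mulr_ge0.
have fi : 0 < i`!%:R :> R by rewrite ltr0n fact_gt0.
have h1 : 'C(r, i)%:R <= r%:R ^+ i / i`!%:R :> R.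
  by rewrite ler_pdivlMr // -natrM bin_ffact -natrX ler_nat ffact_le.
have h2 : (1 - p) ^+ (r - i) <= expR (p * i%:R) * expR (- (p * r%:R)).
  have -> : expR (p * i%:R) * expR (- (p * r%:R)) = expR (- p * (r - i)%:R).
    by rewrite -expRD natrB //; congr expR; ring.
  by rewrite expRM_natr lerXn2r ?nnegrE ?subr_ge0 ?expR_ge0 // expR_ge1Dx.
apply: (@le_trans _ _ (r%:R ^+ i / i`!%:R * (p ^+ i * (expR (p * i%:R) * expR (- (p * r%:R)))))).
  apply: ler_pM => //; first by rewrite mulr_ge0 ?exprn_ge0 ?subr_ge0.
  by rewrite ler_wpM2l ?exprn_ge0.
by rewrite /pois exprMn le_eqVlt; apply/orP; left; apply/eqP; ring.
Qed.

Lemma binomial_cdf_le r j : Ex bern (fun y : {ffun 'I_r -> bool} => (\sum_i y i <= j)%N%:R) <=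
  expR (p * j%:R) * pcdf (p * r%:R) j.+1.
Proof.
have /andP[p0 p1] := p01.
have E (y : {ffun 'I_r -> bool}) : (\sum_i y i <= j)%N%:R = \sum_(i < j.+1) ((\sum_j y j)%N == i)%:R :> R.
  set s := (\sum_i y i)%N; rewrite -ltnS; case: (ltnP s j.+1) => sj.
    rewrite (bigD1 (Ordinal sj)) //= eqxx big1 ?addr0 // => i.
    by rewrite -(inj_eq val_inj) /= eq_sym => /negPf ->.
  by rewrite big1 // => i _; rewrite gtn_eqF // (leq_trans (ltn_ord i)).
rewrite (Ex_ext _ E) Ex_sum /pcdf mulr_sumr; apply: ler_sum => i _.
apply: le_trans (binomial_pmf_le r i) _.
rewrite ler_wpM2r ?pois_ge0 ?mulr_ge0 // ler_expR ler_wpM2l // ler_nat.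
by rewrite -ltnS.
Qed.

Lemma exprB_le (a b : R) k : 0 <= a <= 1 -> 0 <= b <= 1 -> a <= b ->
  b ^+ k - a ^+ k <= k%:R * (b - a).
Proof.
move=> /andP[a0 a1] /andP[b0 b1] ab; elim: k => [|k IH]; first by rewrite subrr mul0r.
rewrite !exprS -natr1 mulrDl mul1r.
have -> : b * b ^+ k - a * a ^+ k = b * (b ^+ k - a ^+ k) + (b - a) * a ^+ k by ring.
have ak : a ^+ k <= b ^+ k by rewrite lerXn2r ?nnegrE.
apply: lerD; last by rewrite ler_piMr ?subr_ge0 // exprn_ile1.
by apply: le_trans IH; rewrite ler_piMl // subr_ge0.
Qed.

(** The winning count is at least the sum over [j < J] of the indicators that some count exceeds
    [j]. Independence of the blocks turns each expectation into [1 - P j ^+ k.+1], and the Poisson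
    comparison costs [(k + 1) (e^(p J) - 1)] for each [j]. *)
Lemma binomial_max_ge k r J (c : {ffun 'I_k.+1 * 'I_r -> bool} -> 'I_k.+1) :
  (forall (x : {ffun 'I_k.+1 * 'I_r -> bool}) i, \sum_j x (i, j) <= \sum_j x (c x, j))%N ->
  emax k.+1 J (p * r%:R) - (J * k.+1)%:R * (expR (p * J%:R) - 1) <=
  Ex bern (fun x => (\sum_j x (c x, j))%N%:R).
Proof.
have /andP[p0 p1] := p01 => cmax.
pose P j := Ex bern (fun y : {ffun 'I_r -> bool} => (\sum_i y i <= j)%N%:R).
have step (x : {ffun 'I_k.+1 * 'I_r -> bool}) : \sum_(j < J) (1 - \prod_(i < k.+1) (\sum_j0 x (i, j0) <= j)%N%:R) <=
    (\sum_j x (c x, j))%N%:R :> R.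
  set N := (\sum_j x (c x, j))%N.
  apply: (@le_trans _ _ (\sum_(j < J) (j < N)%N%:R)).
    apply: ler_sum => j _; case: (ltnP j N) => jN /=.
      by rewrite gerBl prodr_ge0.
    by rewrite big1 ?subrr // => i _; rewrite (leq_trans (cmax x i) jN).
  rewrite -natr_sum ler_nat; clear -N; elim: J => [|J IH]; first by rewrite big_ord0.
  rewrite big_ord_recr /=; case: (ltnP J N) => JN; last by rewrite addn0.
  rewrite addn1; apply: leq_ltn_trans JN; clear; elim: J => [|J IH]; first by rewrite big_ord0.
  by rewrite big_ord_recr /= -addn1 leq_add // leq_b1.
apply: le_trans (Ex_le bern_ge0 step); rewrite Ex_sum.
have EP (j : 'I_J) : Ex bern (fun x : {ffun 'I_k.+1 * 'I_r -> bool} =>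
    1 - \prod_(i < k.+1) (\sum_j0 x (i, j0) <= j)%N%:R) = 1 - P j ^+ k.+1.
  rewrite Ex_sub (Ex_const _ bern_sum); congr (1 - _).
  have := Ex_prod bern (fun (_ : 'I_k.+1) (y : {ffun 'I_r -> bool}) => (\sum_i y i <= j)%N%:R).
  rewrite prodr_const card_ord => <-; apply: Ex_ext => x; apply: eq_bigr => i _.
  by congr ((_ <= _)%N%:R); apply: eq_bigr => j0 _; rewrite ffunE.
rewrite (eq_bigr _ (fun j _ => EP j)).
have -> : (J * k.+1)%:R * (expR (p * J%:R) - 1) = \sum_(j < J) k.+1%:R * (expR (p * J%:R) - 1).
  by rewrite sumr_const card_ord natrM -[RHS]mulr_natl mulrA.
rewrite /emax -sumrB; apply: ler_sum => j _.
set F := pcdf _ _; set e := expR _.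
have l0 : 0 <= p * r%:R by rewrite mulr_ge0.
have F0 : 0 <= F by apply: pcdf_ge0.
have F1 : F <= 1 by apply: pcdf_le1.
have P0 : 0 <= P j by apply: Ex_ge0 => //; [exact: bern_ge0 | exact: bern_sum].
have P1 : P j <= 1.
  rewrite -(Ex_const 'I_r bern_sum 1); apply: Ex_le => [|y]; first exact: bern_ge0.
  by rewrite lern1 leq_b1.
have e1 : 1 <= e by rewrite -expR0 ler_expR mulr_ge0.
have PF : P j <= e * F.
  apply: le_trans (binomial_cdf_le r j) _; rewrite ler_wpM2r // ler_expR ler_wpM2l // ler_nat.
  exact: ltnW.
have k0 : 0 <= k.+1%:R * (e - 1) by rewrite mulr_ge0 ?subr_ge0.
suff : P j ^+ k.+1 - F ^+ k.+1 <= k.+1%:R * (e - 1) by lra.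
case: (lerP (P j) F) => PFle.
  apply: le_trans k0; rewrite subr_le0 lerXn2r ?nnegrE //.
apply: le_trans (exprB_le _ _ _ (ltW PFle)) _; rewrite ?F0 ?P0 //.
rewrite ler_wpM2l //; nra.
Qed.
End Bernoulli.

(** * Choosing the label of one vertex *)

Section Pick.
Variable k : nat.

Definition amax (g : {ffun 'I_k.+1 -> nat}) : 'I_k.+1 := [arg max_(i > ord0) g i].

Lemma amaxP (g : {ffun 'I_k.+1 -> nat}) j : (g j <= g (amax g))%N.
Proof. by rewrite /amax; case: arg_maxnP => // i _; apply. Qed.

Variable r : nat.
Local Notation Sub := {ffun 'I_k.+1 * 'I_r -> bool}.

(* The argmax is taken in a rotated order, so that a uniform [tau] makes the
   tie-breaking equivariant under rotations of the labels. *)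
Definition best_label (x : Sub) (tau : 'I_k.+1) : 'I_k.+1 :=
  amax [ffun i => \sum_j x ((i + tau)%R, j)]%N + tau.

Lemma best_labelP (x : Sub) tau i : (\sum_j x (i, j) <= \sum_j x (best_label x tau, j))%N.
Proof.
have := amaxP [ffun i => \sum_j x ((i + tau)%R, j)]%N (i - tau).
by rewrite !ffunE subrK.
Qed.

Definition rotate (d : 'I_k.+1) (x : Sub) : Sub := [ffun a => x (a.1 - d, a.2)].

Lemma best_label_rotate d x tau :
  best_label (rotate d x) (tau + d) = best_label x tau + d.
Proof.
rewrite /best_label addrA; congr (amax _ + _ + _); apply/ffunP => i; rewrite !ffunE.
by apply: eq_bigr => j _; rewrite ffunE /= addrA addrK.
Qed.

Variables (R : realType) (w : bool -> R).

Lemma Ex_rotate d (f : Sub -> R) : Ex w (fun x => f (rotate d x)) = Ex w f.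
Proof.
rewrite /Ex [RHS](reindex (rotate d)); last first.
  exists (rotate (- d)) => x _; apply/ffunP => -[i j]; rewrite !ffunE /=.
    by rewrite opprK addrK.
  by rewrite opprK subrK.
apply: eq_bigr => x _; congr (_ * _); rewrite [LHS](reindex (fun a => (a.1 - d, a.2))) /=.
  by apply: eq_bigr => a _; rewrite ffunE.
by exists (fun a => (a.1 + d, a.2)) => -[i j] _ /=; rewrite ?subrK ?addrK.
Qed.

(** Rotating [x] and [tau] together shifts the chosen label, so the left side does not depend on
    [i]; summed over [i] it is [(k + 1)] times the right side. *)
Lemma best_label_uniform (f : Sub -> R) i : (forall d x, f (rotate d x) = f x) ->
  \sum_tau Ex w (fun x => f x * (best_label x tau == i)%:R) = Ex w f.
Proof.
move=> fr; pose S i := \sum_tau Ex w (fun x => f x * (best_label x tau == i)%:R).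
have Sd j d : S (j + d) = S j.
  rewrite /S (reindex_inj (addIr d)) /=; apply: eq_bigr => tau _.
  rewrite -(Ex_rotate d); apply: Ex_ext => x.
  by rewrite fr best_label_rotate (inj_eq (addIr d)).
have Si j : S j = S i by rewrite -(Sd i (j - i)) addrC subrK.
have : \sum_j S j = k.+1%:R * Ex w f.
  rewrite /S exchange_big /=.
  transitivity (\sum_(tau < k.+1) Ex w f); last by rewrite sumr_const card_ord mulr_natl.
  apply: eq_bigr => tau _; rewrite -Ex_sum; apply: Ex_ext => x.
  rewrite -mulr_sumr (bigD1 (best_label x tau)) //= eqxx big1 ?addr0 ?mulr1 // => j.
  by rewrite eq_sym => /negPf ->.
rewrite (eq_bigr _ (fun j _ => Si j)) sumr_const card_ord -[LHS]mulr_natl.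
by apply: mulfI; rewrite pnatr_eq0.
Qed.
End Pick.
Arguments best_label_uniform {k r R} w {f} i.

(** * Expectations over the row of one vertex *)

Section Row.
Variables (R : realType) (n k : nat) (p : R).
Hypothesis p01 : 0 <= p <= 1.
Local Notation Row := ({ffun 'I_n -> bool} * 'I_k.+1)%type.

(* A row holds the potential edges of a vertex [v] and a uniform rotation used for
   tie-breaking; only the entries at [u < v] matter. *)
Definition row_weight (t : Row) : R := (\prod_u bern p (t.1 u)) / k.+1%:R.

Definition Er (f : Row -> R) : R := \sum_t row_weight t * f t.

Lemma row_weight_ge0 t : 0 <= row_weight t.
Proof. by rewrite divr_ge0 ?prodr_ge0 // => i _; apply: bern_ge0. Qed.

Lemma Er_E f : Er f = (\sum_tau Ex (bern p) (fun e => f (e, tau))) / k.+1%:R.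
Proof.
rewrite /Er /Ex exchange_big /= pair_bigA mulr_suml; apply: eq_bigr => -[e tau] _ /=.
by rewrite /row_weight /= mulrAC.
Qed.

Lemma row_weight_sum : \sum_t row_weight t = 1.
Proof.
transitivity (Er (fun=> 1)); first by apply: eq_bigr => t _; rewrite mulr1.
rewrite Er_E (eq_bigr (fun=> 1)) => [|tau _]; last by rewrite Ex_const ?bern_sum.
by rewrite sumr_const card_ord divff ?pnatr_eq0.
Qed.

Lemma Er_le f g : (forall t, f t <= g t) -> Er f <= Er g.
Proof. by move=> fg; apply: ler_sum => t _; rewrite ler_wpM2l ?row_weight_ge0. Qed.

Lemma Er_edge u : Er (fun t => (t.1 u)%:R) = p.
Proof.
rewrite Er_E (eq_bigr (fun=> p)) => [|tau _].
  by rewrite sumr_const card_ord -[_ *+ _]mulr_natr mulfK ?pnatr_eq0.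
rewrite (Ex_cond (bern_sum p) u) -[RHS](Ex_const 'I_n (bern_sum p)); apply: Ex_ext => e.
by rewrite /cond big_bool /= !updE mulr1 mulr0 addr0.
Qed.

Lemma Er_sum (P : pred 'I_n) (F : 'I_n -> Row -> R) :
  Er (fun t => \sum_(u | P u) F u t) = \sum_(u | P u) Er (F u).
Proof. by rewrite /Er exchange_big; apply: eq_bigr => t _; rewrite mulr_sumr. Qed.

Lemma Er_edges (P : pred 'I_n) :
  Er (fun t => \sum_(u | P u) (t.1 u)%:R) = p * #|P|%:R.
Proof. by rewrite Er_sum (eq_bigr (fun=> p)) ?sumr_const ?mulr_natr // => u _; exact: Er_edge. Qed.

(** The martingale bound, with the single entries of the row as coordinates, bounds the variance by
    [n p]; then [s^2 <= 2 (s - m)^2 + 2 m^2]. *)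
Lemma Er_edges_sqr (P : pred 'I_n) :
  Er (fun t => (\sum_(u | P u) (t.1 u)%:R) ^+ 2) <= 2 * (n%:R * p) + 2 * (n%:R * p) ^+ 2.
Proof.
set B := _ + _; have /andP[p0 p1] := p01.
suff h : Ex (bern p) (fun e : {ffun 'I_n -> bool} => (\sum_(u | P u) (e u)%:R) ^+ 2) <= B.
  rewrite Er_E ler_pdivrMr ?ltr0Sn // mulr_natr -[k.+1 in leRHS]card_ord -sumr_const.
  exact: ler_sum.
pose X (u : 'I_n) (e : {ffun 'I_n -> bool}) : R := (P u && e u)%:R.
have cX u e : cond (bern p) u (X u) e = (P u)%:R * p.
  rewrite /cond /X big_bool /= !updE !andbT !andbF mulr0 addr0 mulrC //.
have Xad u : adapted u (X u) by move=> e e' h; rewrite /X h.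
have XB u e : cond (bern p) u (fun e => X u e ^+ 2) e <= p.
  by rewrite /cond /X big_bool /= !updE; case: (P u) => /=; lra.
have := Ex_martingale (bern_ge0 p01) (bern_sum p) Xad XB.
set D := Ex _ _ => HD.
pose m := \sum_u (P u)%:R * p.
have m0 : 0 <= m by apply: sumr_ge0 => u _; rewrite mulr_ge0.
have mn : m <= n%:R * p.
  rewrite -[n in n%:R]card_ord mulr_natl -sumr_const; apply: ler_sum => u _.
  by rewrite ler_piMl // lern1 leq_b1.
have -> : B = 2 * (n%:R * p) + 2 * (n%:R * p) ^+ 2 by [].
apply: (@le_trans _ _ (2 * D + 2 * m ^+ 2)); last first.
  by rewrite lerD ?ler_wpM2l // lerXn2r ?nnegrE // mulr_ge0.
rewrite -(Ex_const 'I_n (bern_sum p) (2 * m ^+ 2)) -Ex_scale -Ex_add.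
apply: Ex_le => [|e]; first exact: bern_ge0.
have -> : \sum_v (X v e - cond (bern p) v (X v) e) = \sum_(u | P u) (e u)%:R - m.
  rewrite sumrB /m; congr (_ - _); last by apply: eq_bigr => u _; apply: cX.
  by rewrite [RHS]big_mkcond; apply: eq_bigr => u _; rewrite /X; case: (P u).
set s := \sum_(u | P u) _; have := sqr_ge0 (s - 2 * m); nra.
Qed.

Section Choice.
Variables (r : nat) (th : 'I_k.+1 * 'I_r -> 'I_n) (v : 'I_n).
Hypothesis thI : injective th.
Hypothesis thv : forall a, (th a < v)%N.

Definition row_label (t : Row) : 'I_k.+1 := best_label [ffun a => t.1 (th a)] t.2.

Lemma Er_choice i : Er (fun t => (row_label t == i)%:R) = k.+1%:R^-1.
Proof.
rewrite Er_E -[RHS]mul1r; congr (_ * _).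
rewrite -[RHS](Ex_const ('I_k.+1 * 'I_r)%type (bern_sum p)).
rewrite -[RHS](best_label_uniform (bern p) i) //; apply: eq_bigr => tau _.
rewrite -(Ex_marginal (bern_sum p) _ thI); apply: Ex_ext => e; by rewrite mul1r.
Qed.

Lemma sum_before_split (h : 'I_n -> R) : \sum_(u < n | (u < v)%N) h u =
  \sum_a h (th a) + \sum_(u < n | (u < v)%N && (u \notin codom th)) h u.
Proof.
rewrite (bigID (mem (codom th))) /=; congr (_ + _).
rewrite (eq_bigl (fun u => u \in finset.imset th (mem predT))).
  by rewrite big_imset // => a b _ _; apply: thI.
move=> u; apply/andP/imsetP => [[_ /codomP[a ->]]|[a _ ->]]; first by exists a.
by rewrite thv codom_f.
Qed.

(** Edges outside the block read by [th] are independent of the label. Inside it only the total edge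
    count matters; it is invariant under rotation, so [best_label_uniform] makes it uncorrelated
    with the label. *)
Lemma Er_back_choice i :
  Er (fun t => (\sum_(u < n | (u < v)%N) (t.1 u)%:R) * (row_label t == i)%:R) = p * v%:R / k.+1%:R.
Proof.
have cardv : \sum_(u < n | (u < v)%N) p = p * v%:R.
  rewrite -(big_ord_widen n (fun=> p)) ?(ltnW (ltn_ord v)) //.
  by rewrite sumr_const card_ord mulr_natr.
rewrite -cardv sum_before_split Er_E; congr (_ / _).
pose g tau (x : {ffun 'I_k.+1 * 'I_r -> bool}) : R := (best_label x tau == i)%:R.
transitivity (\sum_tau (Ex (bern p) (fun x : {ffun 'I_k.+1 * 'I_r -> bool} =>
     (\sum_a (x a)%:R) * g tau x) +
   (\sum_(u < n | (u < v)%N && (u \notin codom th)) p) *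
     Ex (bern p) (fun x : {ffun 'I_k.+1 * 'I_r -> bool} => 1 * g tau x))).
  apply: eq_bigr => tau _; rewrite -!(Ex_marginal (bern_sum p) _ thI) mulr_suml.
  pose G (e : {ffun 'I_n -> bool}) := g tau [ffun a => e (th a)].
  transitivity (Ex (bern p) (fun e => (\sum_a (e (th a))%:R) * G e +
      \sum_(u < n | (u < v)%N && (u \notin codom th)) (e u)%:R * G e)).
    by apply: Ex_ext => e; rewrite sum_before_split mulrDl; congr (_ + _); rewrite mulr_suml.
  rewrite Ex_add Ex_sum; congr (_ + _).
    apply: Ex_ext => e; congr (_ * _); by apply: eq_bigr => a _; rewrite ffunE.
  apply: eq_bigr => u /andP[_ uN].
  rewrite (Ex_cond (bern_sum p) u) -Ex_scale; apply: Ex_ext => e.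
  have Gu b : G (upd e u b) = G e.
    congr (g tau _); apply/ffunP => a; rewrite !ffunE.
    by case: eqP uN => // <-; rewrite codom_f.
  by rewrite /cond big_bool /= !Gu !updE mul0r mulr0 addr0 -/(G e) !mul1r.
rewrite big_split /= -mulr_sumr !best_label_uniform //; last first.
  move=> d x; rewrite [RHS](reindex (fun a => (a.1 - d, a.2))) /=.
    by apply: eq_bigr => a _; rewrite ffunE.
  by exists (fun a => (a.1 + d, a.2)) => -[j m] _ /=; rewrite ?subrK ?addrK.
rewrite (Ex_const _ (bern_sum p)) mulr1; congr (_ + _).
rewrite Ex_sum; apply: eq_bigr => a _.
rewrite (Ex_cond (bern_sum p) a) -[RHS](Ex_const ('I_k.+1 * 'I_r)%type (bern_sum p)).
by apply: Ex_ext => e; rewrite /cond big_bool /= !updE mulr1 mulr0 addr0.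
Qed.

Lemma Er_choice_max J :
  emax k.+1 J (p * r%:R) - (J * k.+1)%:R * (expR (p * J%:R) - 1) <=
  Er (fun t => (\sum_j t.1 (th (row_label t, j)))%N%:R).
Proof.
set m := emax _ _ _ - _; rewrite Er_E ler_pdivlMr ?ltr0Sn //.
have -> : m * k.+1%:R = \sum_(tau < k.+1) m by rewrite sumr_const card_ord mulr_natr.
apply: ler_sum => tau _.
have H := @binomial_max_ge R p p01 k r J (fun x => best_label x tau) (fun x => best_labelP x tau).
apply: le_trans H _.
rewrite -(Ex_marginal (bern_sum p) _ thI) le_eqVlt; apply/orP; left; apply/eqP.
by apply: Ex_ext => e; congr (_%:R); apply: eq_bigr => j _; rewrite ffunE.
Qed.
End Choice.
End Row.

(** * The greedy labelling *)

Section Greedy.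
Variables (n k : nat).
Local Notation Row := ({ffun 'I_n -> bool} * 'I_k.+1)%type.
Local Notation labels := {ffun 'I_n -> 'I_k.+1}.
Local Notation Om := {ffun 'I_n -> Row}.

Definition occs (l : labels) (v : 'I_n) : {ffun 'I_k.+1 -> seq 'I_n} :=
  [ffun i => [seq u : 'I_n <- enum 'I_n | (u < v)%N && (l u == i)]].

(* The choice only looks at the same number [rmin] of vertices of each label, so that
   the competing counts are independent and identically distributed. *)
Definition rmin (o : {ffun 'I_k.+1 -> seq 'I_n}) : nat :=
  size (o [arg min_(i < ord0) size (o i)]%N).

Definition pos (o : {ffun 'I_k.+1 -> seq 'I_n}) (v : 'I_n) (a : 'I_k.+1 * 'I_(rmin o)) : 'I_n :=
  nth v (o a.1) a.2.

Definition next_label (l : labels) (v : 'I_n) (t : Row) : 'I_k.+1 :=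
  row_label (pos v (o := occs l v)) t.

Fixpoint partial_labels (om : Om) (m : nat) : labels :=
  if m is m'.+1 then
    [ffun v : 'I_n => if v == m' :> nat then next_label (partial_labels om m') v (om v)
                      else partial_labels om m' v]
  else [ffun=> ord0].

Definition greedy (om : Om) : labels := partial_labels om n.

Definition agree_below (v : nat) (l l' : labels) := forall u : 'I_n, (u < v)%N -> l u = l' u.

Lemma rmin_le o i : (rmin o <= size (o i))%N.
Proof. by rewrite /rmin; case: arg_minnP => // j _; apply. Qed.

Lemma pos_mem l v (a : 'I_k.+1 * 'I_(rmin (occs l v))) :
  pos v a \in occs l v a.1.
Proof. by rewrite mem_nth // (leq_trans (ltn_ord _)) ?rmin_le. Qed.

Lemma pos_lt l v (a : 'I_k.+1 * 'I_(rmin (occs l v))) : (pos v a < v)%N.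
Proof. by have := @pos_mem l v a; rewrite ffunE mem_filter => /andP[/andP[]]. Qed.

Lemma pos_label l v (a : 'I_k.+1 * 'I_(rmin (occs l v))) : l (pos v a) = a.1.
Proof. by have := @pos_mem l v a; rewrite ffunE mem_filter => /andP[/andP[_ /eqP]]. Qed.

Lemma pos_inj l v : injective (pos v (o := occs l v)).
Proof.
move=> [i a] [j b] E; have := pos_label (i, a); rewrite E pos_label /= => ji.
rewrite -ji in E *; congr (_, _); apply/val_inj/eqP; move/eqP: E; rewrite /pos /=.
rewrite nth_uniq //; rewrite ?(leq_trans (ltn_ord _)) ?rmin_le //.
by rewrite ffunE filter_uniq ?enum_uniq.
Qed.

Lemma occs_agree (v : 'I_n) l l' : agree_below v l l' -> occs l v = occs l' v.
Proof.
move=> h; apply/ffunP => i; rewrite !ffunE; apply: eq_filter => u.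
by case: ltnP => // /h ->.
Qed.

Lemma next_label_agree (v : 'I_n) l l' t : agree_below v l l' -> next_label l v t = next_label l' v t.
Proof. by move=> /occs_agree; rewrite /next_label => ->. Qed.

Lemma partial_labels_stable om m m' (u : 'I_n) : (u < m)%N -> (m <= m')%N ->
  partial_labels om m' u = partial_labels om m u.
Proof.
move=> um /subnKC <-; elim: (m' - m)%N => [|d IH]; first by rewrite addn0.
by rewrite addnS /= ffunE ltn_eqF // (leq_trans um) // leq_addr.
Qed.

(** A fixed-point equation for the final labelling, possible because [next_label] reads only earlier
    labels; later arguments need no partial run. *)
Lemma greedyE om v : greedy om v = next_label (greedy om) v (om v).
Proof.
rewrite /greedy (@partial_labels_stable _ v.+1) //= ffunE eqxx.
apply: next_label_agree => u uv.
by rewrite (@partial_labels_stable om v n) // ltnW.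
Qed.

Lemma partial_labels_ext (om om' : Om) m : (forall u : 'I_n, (u < m)%N -> om u = om' u) ->
  partial_labels om m = partial_labels om' m.
Proof.
elim: m => [//|m IH] h; apply/ffunP => v; rewrite /= !ffunE.
rewrite IH => [|u um]; last by rewrite h // ltnW.
by case: eqP => // vm; rewrite h // vm.
Qed.

Lemma greedy_ext (om om' : Om) m : (forall u : 'I_n, (u < m)%N -> om u = om' u) ->
  agree_below m (greedy om) (greedy om').
Proof.
move=> h u um; rewrite /greedy (@partial_labels_stable om u.+1) //.
rewrite (@partial_labels_stable om' u.+1) // (partial_labels_ext (om' := om')) // => z zu.
by rewrite h // (leq_trans zu).
Qed.

Variables (R : realType) (p : R).
Hypothesis p01 : 0 <= p <= 1.
Local Notation w := (@row_weight R n k p).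

Section Local.
Variable F : labels -> 'I_n -> Row -> R.
Hypothesis Floc : forall l l' (v : 'I_n) t, agree_below v l l' -> F l v t = F l' v t.

Lemma adapted_greedy v : adapted v (fun om => F (greedy om) v (om v)).
Proof.
move=> om om' h; rewrite (h v) //; apply: Floc; apply: greedy_ext => u uv.
by rewrite h // ltnW.
Qed.

(** Resampling the row of [v] leaves the labels before [v] unchanged, so the labelling can be frozen
    and only one row is averaged. *)
Lemma cond_greedy v om : cond w v (fun om => F (greedy om) v (om v)) om =
  Er p (F (greedy om) v).
Proof.
rewrite /cond /Er; apply: eq_bigr => t _; rewrite updE; congr (_ * _).
by apply: Floc; apply: greedy_ext => u uv; rewrite upd_neq // -(inj_eq val_inj) ltn_eqF.
Qed.

Lemma greedy_martingale B : (forall l v, Er p (fun t => F l v t ^+ 2) <= B) ->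
  Ex w (fun om => (\sum_v (F (greedy om) v (om v) - Er p (F (greedy om) v))) ^+ 2) <= n%:R * B.
Proof.
move=> hB; have := @Ex_martingale R n _ w (row_weight_ge0 p01) (row_weight_sum n k p)
  (fun v om => F (greedy om) v (om v)) B adapted_greedy.
under Ex_ext do under eq_bigr do rewrite cond_greedy.
apply=> v om; apply: le_trans (hB (greedy om) v); rewrite le_eqVlt; apply/orP; left; apply/eqP.
rewrite /cond /Er; apply: eq_bigr => t _; rewrite updE; congr (_ * (_ ^+ 2)).
by apply: Floc; apply: greedy_ext => u uv; rewrite upd_neq // -(inj_eq val_inj) ltn_eqF.
Qed.
End Local.

Definition back (v : 'I_n) (t : Row) : R := \sum_(u < n | (u < v)%N) (t.1 u)%:R.
Definition count_label (l : labels) (v : 'I_n) i : R := \sum_(u < n | (u < v)%N) (l u == i)%:R.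

(** An edge between [u < v] adds to the volume of class [i] once through the label of [v] ([F_back])
    and once through that of [u] ([F_fwd]); [F_in] collects the edges inside classes. Each is a sum
    of terms revealed with row [v]. *)
Definition F_label (m : 'I_n) i (l : labels) (v : 'I_n) (t : Row) : R :=
  (v < m)%N%:R * (next_label l v t == i)%:R.
Definition F_back i (l : labels) (v : 'I_n) (t : Row) : R :=
  back v t * (next_label l v t == i)%:R.
Definition F_fwd i (l : labels) (v : 'I_n) (t : Row) : R :=
  \sum_(u < n | (u < v)%N && (l u == i)) (t.1 u)%:R.
Definition F_in (l : labels) (v : 'I_n) (t : Row) : R := F_fwd (next_label l v t) l v t.

Lemma F_fwd_agree i l l' (v : 'I_n) t : agree_below v l l' -> F_fwd i l v t = F_fwd i l' v t.
Proof. by move=> h; apply: eq_bigl => u; case: ltnP => //= /h ->. Qed.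

Lemma F_label_local m i l l' (v : 'I_n) t : agree_below v l l' -> F_label m i l v t = F_label m i l' v t.
Proof. by move=> h; rewrite /F_label (next_label_agree t h). Qed.

Lemma F_back_local i l l' (v : 'I_n) t : agree_below v l l' -> F_back i l v t = F_back i l' v t.
Proof. by move=> h; rewrite /F_back (next_label_agree t h). Qed.

Lemma F_in_local l l' (v : 'I_n) t : agree_below v l l' -> F_in l v t = F_in l' v t.
Proof. by move=> h; rewrite /F_in (next_label_agree t h) (F_fwd_agree _ _ h). Qed.

Lemma sum_below (v : 'I_n) (a : R) : \sum_(u < n | (u < v)%N) a = v%:R * a.
Proof.
rewrite -(big_ord_widen n (fun=> a)) ?(ltnW (ltn_ord v)) //.
by rewrite sumr_const card_ord mulr_natl.
Qed.

Lemma Er_scale (a : R) (f : Row -> R) : Er p (fun t => a * f t) = a * Er p f.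
Proof. by rewrite /Er mulr_sumr; apply: eq_bigr => t _; rewrite mulrCA. Qed.

Lemma Er_F_label m i l v : Er p (F_label m i l v) = (v < m)%N%:R / k.+1%:R.
Proof. by rewrite Er_scale Er_choice //; exact: pos_inj. Qed.

Lemma Er_F_back i l v : Er p (F_back i l v) = p * v%:R / k.+1%:R.
Proof. by rewrite Er_back_choice //; [exact: pos_inj | move=> a; apply: pos_lt]. Qed.

Lemma Er_F_fwd i l v : Er p (F_fwd i l v) = p * count_label l v i.
Proof.
rewrite Er_edges //; congr (_ * _); rewrite /count_label -sum1_card natr_sum big_mkcondr /=.
by apply: eq_bigr => u _; case: eqP.
Qed.

Lemma count_label_size l v i : count_label l v i = (size (occs l v i))%:R.
Proof.
rewrite ffunE size_filter -sum1_count natr_sum big_enum_cond /=.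
by rewrite big_mkcondr /=; apply: eq_bigr => u _; case: eqP.
Qed.

(** [F_in] counts all earlier neighbours with the chosen label, hence at least those in the
    competing block. *)
Lemma Er_F_in J l v : emax k.+1 J (p * (rmin (occs l v))%:R)
    - (J * k.+1)%:R * (expR (p * J%:R) - 1) <= Er p (F_in l v).
Proof.
apply: le_trans (Er_choice_max p01 (@pos_inj l v) J) _.
apply: Er_le => // t; rewrite -/(next_label l v t) natr_sum /F_in /F_fwd.
set i := next_label l v t.
have inj : injective (fun j => pos v (o := occs l v) (i, j)).
  by move=> a b /pos_inj [].
rewrite -(big_imset (fun u => (t.1 u)%:R : R) (h := fun j => pos v (i, j)) (A := predT)) /=; last first.
  by move=> a b _ _; apply: inj.
rewrite [leRHS](bigID (mem (finset.imset (fun j => pos v (o := occs l v) (i, j)) (mem predT)))) /=.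
rewrite -[leLHS]addr0 lerD ?sumr_ge0 // le_eqVlt; apply/orP; left; apply/eqP.
apply: eq_bigl => u; apply/imsetP/andP => [[j _ ->]|[_ /imsetP //]].
by rewrite pos_lt pos_label eqxx; split=> //; apply: (imset_f (fun j => pos v (i, j))).
Qed.

Lemma back_ge0 v t : 0 <= back v t. Proof. exact: sumr_ge0. Qed.

Lemma F_back_sqr i l v t : F_back i l v t ^+ 2 <= back v t ^+ 2.
Proof.
rewrite lerXn2r ?nnegrE ?mulr_ge0 ?back_ge0 //.
by rewrite ler_piMr ?back_ge0 // lern1 leq_b1.
Qed.

Lemma F_fwd_sqr i l v t : F_fwd i l v t ^+ 2 <= back v t ^+ 2.
Proof.
rewrite lerXn2r ?nnegrE ?back_ge0 //; first exact: sumr_ge0.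
by rewrite /F_fwd big_mkcondr; apply: ler_sum => u _; case: eqP.
Qed.

Definition row_var : R := 2 * (n%:R * p) + 2 * (n%:R * p) ^+ 2.

Lemma Er_back_sqr v : Er p (fun t : Row => back v t ^+ 2) <= row_var.
Proof. exact: Er_edges_sqr. Qed.

Lemma Ex_dev v i :
  Ex w (fun om => `|count_label (greedy om) v i - v%:R / k.+1%:R|) <= Num.sqrt n%:R.
Proof.
have n0 : 0 < n%:R :> R by rewrite ltr0n (leq_ltn_trans (leq0n v)).
have s0 : 0 < Num.sqrt n%:R :> R by rewrite sqrtr_gt0.
have F1 l u : Er p (fun t => F_label v i l u t ^+ 2) <= 1.
  rewrite -(row_weight_sum n k p) -[leRHS](eq_bigr _ (fun t _ => mulr1 _)).
  apply: Er_le => // t; rewrite /F_label exprMn -!natrX -natrM lern1.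
  by case: (u < v)%N; case: eqP.
have H := greedy_martingale (@F_label_local v i) F1.
pose f om : R := count_label (greedy om) v i - v%:R / k.+1%:R.
have := @Ex_norm_le R 'I_n Row w (row_weight_ge0 p01) (row_weight_sum n k p) f _ 1 s0.
rewrite (_ : (1 + 1) / 2 = 1 :> R) ?mul1r; last lra.
apply; rewrite sqr_sqrtr ?ler0n // -[leRHS]mulr1; apply: le_trans H; rewrite /f.
rewrite le_eqVlt; apply/orP; left; apply/eqP; apply: Ex_ext => om; congr (_ ^+ 2).
rewrite sumrB; congr (_ - _).
  rewrite /count_label big_mkcond; apply: eq_bigr => u _.
  by rewrite /F_label -greedyE; case: (u < v)%N; rewrite ?mul1r ?mul0r.
under [RHS]eq_bigr do rewrite Er_F_label.
rewrite -(sum_below v k.+1%:R^-1) [LHS]big_mkcond; apply: eq_bigr => u _.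
by case: (u < v)%N; rewrite ?mul1r ?mul0r.
Qed.

(** [S_fwd] is centred at the random mean [p count_label]; [total_dev] bounds the cost of replacing
    it by [p v / K]. *)
Definition S_back i (om : Om) : R :=
  \sum_v F_back i (greedy om) v (om v) - \sum_(v < n) p * v%:R / k.+1%:R.
Definition S_fwd i (om : Om) : R :=
  \sum_v (F_fwd i (greedy om) v (om v) - p * count_label (greedy om) v i).
Definition S_in (om : Om) : R :=
  \sum_v (F_in (greedy om) v (om v) - Er p (F_in (greedy om) v)).
Definition total_dev i (om : Om) : R :=
  \sum_(v < n) p * `|count_label (greedy om) v i - v%:R / k.+1%:R|.

Lemma Ex_S_back i : Ex w (fun om => S_back i om ^+ 2) <= n%:R * row_var.
Proof.
have hB l v : Er p (fun t => F_back i l v t ^+ 2) <= row_var.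
  by apply: le_trans (Er_back_sqr v); apply: Er_le => // t; apply: F_back_sqr.
apply: le_trans (greedy_martingale (@F_back_local i) hB).
rewrite le_eqVlt; apply/orP; left; apply/eqP; apply: Ex_ext => om; congr (_ ^+ 2).
by rewrite /S_back -sumrB; apply: eq_bigr => v _; rewrite Er_F_back.
Qed.

Lemma Ex_S_fwd i : Ex w (fun om => S_fwd i om ^+ 2) <= n%:R * row_var.
Proof.
have hB l v : Er p (fun t => F_fwd i l v t ^+ 2) <= row_var.
  by apply: le_trans (Er_back_sqr v); apply: Er_le => // t; apply: F_fwd_sqr.
apply: le_trans (greedy_martingale (@F_fwd_agree i) hB).
rewrite le_eqVlt; apply/orP; left; apply/eqP; apply: Ex_ext => om; congr (_ ^+ 2).
by apply: eq_bigr => v _; rewrite Er_F_fwd.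
Qed.

Lemma Ex_S_in : Ex w (fun om => S_in om ^+ 2) <= n%:R * row_var.
Proof.
have hB l v : Er p (fun t => F_in l v t ^+ 2) <= row_var.
  by apply: le_trans (Er_back_sqr v); apply: Er_le => // t; apply: F_fwd_sqr.
exact (greedy_martingale (@F_in_local) hB).
Qed.

Lemma Ex_total_dev i : Ex w (total_dev i) <= n%:R * p * Num.sqrt n%:R.
Proof.
have /andP[p0 _] := p01.
rewrite /total_dev Ex_sum -mulrA -[n in n%:R * _]card_ord mulr_natl -sumr_const.
apply: ler_sum => v _; rewrite Ex_scale ler_wpM2l //; exact: Ex_dev.
Qed.

(** The smallest class has at least [v / K] members minus its own deviation, which the sum over all
    labels dominates; [emax_lip] converts this into a loss for [emax]. *)
Lemma Er_F_in_dev J om (v : 'I_n) : emax k.+1 J (p * (v%:R / k.+1%:R))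
    - (J * k.+1)%:R * (expR (p * J%:R) - 1)
    - k.+1%:R * (\sum_i p * `|count_label (greedy om) v i - v%:R / k.+1%:R|)
  <= Er p (F_in (greedy om) v).
Proof.
have /andP[p0 _] := p01; apply: le_trans (Er_F_in J _ v).
set o := occs _ _; set x : R := v%:R / k.+1%:R; set y : R := (rmin o)%:R.
have x0 : 0 <= x by rewrite divr_ge0.
have y0 : 0 <= y by rewrite ler0n.
rewrite addrAC lerD2r -mulr_sumr.
set D := \sum_i _; have D0 : 0 <= D by apply: sumr_ge0.
have xyD : x - y <= D.
  rewrite /y /rmin; set i := (X in size (o X)).
  rewrite -count_label_size /D (bigD1 i) //=.
  apply: le_trans (_ : `|count_label (greedy om) v i - x| <= _).
    by rewrite distrC ler_norm.
  by rewrite lerDl sumr_ge0.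
case: (lerP x y) => xy.
  apply: (@le_trans _ _ (emax k.+1 J (p * x))).
    by rewrite gerBl !mulr_ge0.
  by apply: emax_le; rewrite mulr_ge0 //= ler_wpM2l.
have := @emax_lip R k J (p * y) (p * x).
rewrite mulr_ge0 //= ler_wpM2l ?(ltW xy) // => /(_ isT).
have : k.+1%:R * (p * x - p * y) <= k.+1%:R * (p * D).
  by rewrite -mulrBr !ler_wpM2l.
lra.
Qed.

Definition bad (e : R) (om : Om) : bool :=
  (e * n%:R <= `|S_in om|) || [exists i, [|| e * n%:R <= `|S_back i om|,
    e * n%:R <= `|S_fwd i om| | e * n%:R <= total_dev i om]].

(** Union bound over [2 K + 1] Chebyshev events and [K] Markov events. For [p = c / n] one has
    [row_var = 2 c + 2 c^2], so the two terms are of order [1 / n] and [1 / sqrt n]. *)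
Lemma Ex_bad e : (0 < n)%N -> 0 < e -> Ex w (fun om => (bad e om)%:R) <=
  (2 * k.+1 + 1)%:R * (row_var / (e ^+ 2 * n%:R)) +
  k.+1%:R * (n%:R * p / (e * Num.sqrt n%:R)).
Proof.
move=> n0 e0; have N0 : 0 < n%:R :> R by rewrite ltr0n.
have s0 : 0 < Num.sqrt n%:R :> R by rewrite sqrtr_gt0.
have a0 : 0 < e * n%:R by rewrite mulr_gt0.
have /andP[p0 _] := p01.
have w0 := row_weight_ge0 (n := n) (k := k) p01.
set A := row_var / _; set B := n%:R * p / _.
have cheb (f : Om -> R) : Ex w (fun om => f om ^+ 2) <= n%:R * row_var ->
    Ex w (fun om => (e * n%:R <= `|f om|)%R%:R) <= A.
  move=> h; apply: le_trans (Ex_chebyshev w0 f a0) _.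
  rewrite ler_pdivrMr ?exprn_gt0 //; apply: le_trans h _.
  by rewrite /A le_eqVlt; apply/orP; left; apply/eqP; field; rewrite !gt_eqF.
have mark i : Ex w (fun om => (e * n%:R <= total_dev i om)%R%:R) <= B.
  apply: le_trans (Ex_markov w0 _ a0) _.
    by move=> om; apply: sumr_ge0 => v _; rewrite mulr_ge0.
  rewrite ler_pdivrMr //; apply: le_trans (Ex_total_dev i) _.
  rewrite /B -[n%:R in X in _ <= _ * (e * X)](sqr_sqrtr (ltW N0)).
  by rewrite le_eqVlt; apply/orP; left; apply/eqP; field; rewrite !gt_eqF.
apply: (@le_trans _ _ (Ex w (fun om => (e * n%:R <= `|S_in om|)%R%:R +
   \sum_i ((e * n%:R <= `|S_back i om|)%R%:R + (e * n%:R <= `|S_fwd i om|)%R%:R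
     + (e * n%:R <= total_dev i om)%R%:R)))).
  apply: Ex_le => // om; rewrite /bad.
  case: (e * n%:R <= `|S_in om|) => /=.
    by rewrite lerDl sumr_ge0 // => i _; rewrite !addr_ge0.
  rewrite add0r; case: existsP => [[i hi]|_]; last first.
    by apply: sumr_ge0 => i _; rewrite !addr_ge0.
  rewrite (bigD1 i) //= -[leLHS]addr0 lerD //; last first.
    by apply: sumr_ge0 => j _; rewrite !addr_ge0.
  rewrite -!natrD ler_nat; move: hi.
  by case: (_ <= _); case: (_ <= _); case: (_ <= _).
rewrite Ex_add Ex_sum.
have -> : (2 * k.+1 + 1)%:R * A + k.+1%:R * B = A + \sum_(i < k.+1) (A + A + B).
  by rewrite sumr_const card_ord -[_ *+ _]mulr_natl natrD natrM; ring.
apply: lerD; first exact/cheb/Ex_S_in.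
apply: ler_sum => i _; rewrite !Ex_add.
by rewrite !lerD ?cheb ?mark ?Ex_S_back ?Ex_S_fwd.
Qed.

Lemma good_in J e om : ~~ bad e om ->
  \sum_(v < n) emax k.+1 J (p * (v%:R / k.+1%:R))
   - n%:R * ((J * k.+1)%:R * (expR (p * J%:R) - 1)) - (k.+1%:R ^+ 2 + 1) * (e * n%:R)
  <= \sum_v F_in (greedy om) v (om v).
Proof.
rewrite /bad negb_or -ltNge => /andP[hin /existsPn hi].
have /andP[p0 _] := p01.
have h1 : \sum_v Er p (F_in (greedy om) v) - e * n%:R <= \sum_v F_in (greedy om) v (om v).
  have := ltW hin; rewrite ler_norml /S_in sumrB => /andP[h _]; lra.
apply: le_trans h1.
have h2 i : total_dev i om <= e * n%:R.
  by have := hi i; rewrite !negb_or -!ltNge => /and3P[_ _ /ltW].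
have h3 := ler_sum _ (fun v (_ : true) => Er_F_in_dev J om v).
have h4 : \sum_i total_dev i om <= k.+1%:R * (e * n%:R).
  rewrite -[k.+1 in leRHS]card_ord mulr_natl -sumr_const; exact: ler_sum.
move: (h3 (index_enum _)); rewrite !sumrB /= sumr_const card_ord -[_ *+ n]mulr_natl -mulr_sumr.
have -> : \sum_(v < n) \sum_(i < k.+1) p * `|count_label (greedy om) v i - v%:R / k.+1%:R| =
  \sum_i total_dev i om by rewrite exchange_big.
have : k.+1%:R * (\sum_i total_dev i om) <= k.+1%:R * (k.+1%:R * (e * n%:R)).
  by rewrite ler_wpM2l.
lra.
Qed.

Lemma good_volume e om i : ~~ bad e om ->
  `|\sum_v F_back i (greedy om) v (om v) + \sum_v F_fwd i (greedy om) v (om v)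
    - 2 * \sum_(v < n) p * v%:R / k.+1%:R| <= 3 * (e * n%:R).
Proof.
rewrite /bad negb_or => /andP[_ /existsPn /(_ i)]; rewrite !negb_or -!ltNge.
move=> /and3P[/ltW h1 /ltW h2 /ltW h3]; have /andP[p0 _] := p01.
have h4 : `|\sum_v p * count_label (greedy om) v i - \sum_(v < n) p * v%:R / k.+1%:R| <= total_dev i om.
  rewrite -sumrB; apply: le_trans (ler_norm_sum _ _ _) _; apply: ler_sum => v _.
  by rewrite -mulrA -mulrBr normrM (ger0_norm p0).
move: h1 h2 h3 h4; rewrite /S_back /S_fwd sumrB !ler_norml.
move=> /andP[? ?] /andP[? ?] ? /andP[? ?]; apply/andP; split; lra.
Qed.

(** [integral_ge] controls right endpoints while the sum runs over left ones; the shift costs a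
    single value of [emax], at most [J]. *)
Lemma riemann_emax J I : 0 < p -> integral_ge (emax k.+1 J) 0 (n%:R * p / k.+1%:R) I ->
  k.+1%:R / p * I - J%:R <= \sum_(v < n) emax k.+1 J (p * (v%:R / k.+1%:R)).
Proof.
move=> p0 [Psi hPsi <-].
set h := p / k.+1%:R; have h0 : 0 < h by rewrite divr_gt0 ?ltr0Sn.
have E v : p * (v%:R / k.+1%:R) = v%:R * h by rewrite /h; ring.
have step v : (v < n)%N -> Psi (v.+1%:R * h) - Psi (v%:R * h) <= h * emax k.+1 J (v.+1%:R * h).
  move=> vn; apply: le_trans (hPsi _ _ _ _ _) _.
  - by rewrite mulr_ge0 ?(ltW h0).
  - by rewrite ler_wpM2r ?(ltW h0) // ler_nat.
  - by rewrite -mulrA ler_wpM2r ?(ltW h0) // ler_nat.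
  by rewrite -mulrBl -natrB // subSnn mul1r.
have tel m : (m <= n)%N -> Psi (m%:R * h) - Psi 0 <=
    h * (\sum_(v < m) emax k.+1 J (v%:R * h) + emax k.+1 J (m%:R * h) - emax k.+1 J 0).
  elim: m => [|m IH] mn; first by rewrite big_ord0 mul0r !subrr add0r subrr mulr0.
  rewrite big_ord_recr /=; have := step m mn; have := IH (ltnW mn); lra.
have := tel n (leqnn n).
have J1 : emax k.+1 J (n%:R * h) <= J%:R.
  have -> : J%:R = \sum_(j < J) (1 : R) by rewrite sumr_const card_ord.
  have nh0 : 0 <= n%:R * h by apply: mulr_ge0 => //; apply: ltW.
  by apply: ler_sum => j _; rewrite gerBl; apply/exprn_ge0/pcdf_ge0.
have J0 : 0 <= emax k.+1 J (0 : R).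
  by rewrite /emax; apply: sumr_ge0 => j _; rewrite subr_ge0 pcdf_exp_le1.
have -> : \sum_(v < n) emax k.+1 J (p * (v%:R / k.+1%:R)) = \sum_(v < n) emax k.+1 J (v%:R * h).
  by apply: eq_bigr => v _; rewrite E.
set S := \sum_(v < n) _ => hS; rewrite -[n%:R * p / _]mulrA -/h.
have -> : k.+1%:R / p = h^-1 by rewrite /h invf_div.
rewrite lerBlDr mulrC ler_pdivrMr //; apply: le_trans hS _.
by rewrite mulrC ler_wpM2r ?(ltW h0) //; lra.
Qed.
End Greedy.

(** * The random graph and its modularity *)

Section Graph.
Variables (n k : nat).
Local Notation Row := ({ffun 'I_n -> bool} * 'I_k.+1)%type.
Local Notation Om := {ffun 'I_n -> Row}.

Definition edge (q : 'I_n * 'I_n) : {set 'I_n} := [set q.1; q.2]%SET.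
Definition below : {set 'I_n * 'I_n} := finset (fun q : 'I_n * 'I_n => (q.2 < q.1)%N).
Definition arcs (om : Om) : {set 'I_n * 'I_n} :=
  finset (fun q : 'I_n * 'I_n => (q.2 < q.1)%N && (om q.1).1 q.2).
Definition edge_set (om : Om) : {set {set 'I_n}} := finset.imset edge (mem (arcs om)).

Lemma edge_set_card2 om : [forall e in edge_set om, #|e| == 2].
Proof.
apply/forallP => e; apply/implyP => /imsetP[q]; rewrite inE => /andP[lt _] ->.
by rewrite /edge cards2 neq_ltn lt orbT.
Qed.

Definition row_graph (om : Om) : sgraph 'I_n := SGraph (edge_set_card2 om).

Lemma edge_inj : {in below &, injective edge}.
Proof.
move=> [a b] [c d]; rewrite !inE /= => ba dc E.
have ha : a \in edge (c, d) by rewrite -E /edge !inE eqxx.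
have hb : b \in edge (c, d) by rewrite -E /edge !inE eqxx orbT.
move: ha hb; rewrite /edge !inE /= => /orP[/eqP ac|/eqP ad] /orP[/eqP bc|/eqP bd].
- by move: ba; rewrite ac bc ltnn.
- by rewrite ac bd.
- by move: ba; rewrite ad bc ltnNge (ltnW dc).
- by move: ba; rewrite ad bd ltnn.
Qed.

Lemma arcs_below om : {subset arcs om <= below}.
Proof. by move=> q; rewrite !inE => /andP[]. Qed.

Lemma edge_in_row_graph om q : q \in below -> (edge q \in edges (row_graph om)) = (om q.1).1 q.2.
Proof.
move=> qb; apply/imsetP/idP => [[q' q'a E]|h].
  have E' : q = q' by apply: edge_inj => //; apply: arcs_below q'a.
  by move: q'a; rewrite -E' inE => /andP[].
by exists q => //; move: qb; rewrite !inE => ->.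
Qed.

Lemma card_edges_pred om (Q : pred {set 'I_n}) :
  #|[set e in edges (row_graph om) | Q e]%SET| = (\sum_(q in arcs om) Q (edge q))%N.
Proof.
have -> : [set e in edges (row_graph om) | Q e]%SET =
    finset.imset edge (mem (finset (fun q => (q \in arcs om) && Q (edge q)))).
  apply/setP => e; rewrite inE; apply/andP/imsetP.
    by move=> [/imsetP[q qa ->] Qe]; exists q => //; rewrite inE qa.
  by move=> [q]; rewrite inE => /andP[qa Qe] ->; split=> //; apply: imset_f.
rewrite card_in_imset; last first.
  by move=> q q'; rewrite !inE => /andP[/andP[h1 _] _] /andP[/andP[h2 _] _]; apply: edge_inj; rewrite inE.
rewrite -sum1_card big_mkcond [RHS]big_mkcond; apply: eq_bigr => q _; rewrite inE.
by case: (q \in arcs om) => //=; case: (Q _).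
Qed.

Lemma card_row_edges om : #|edges (row_graph om)| = #|arcs om|.
Proof.
have := card_edges_pred om predT; rewrite sum1_card => <-.
by apply: eq_card => e; rewrite !inE andbT.
Qed.

Lemma edges_within_row om A :
  edges_within (row_graph om) A = (\sum_(q in arcs om) ((q.1 \in A) && (q.2 \in A)))%N.
Proof.
rewrite /edges_within card_edges_pred; apply: eq_bigr => q _; congr nat_of_bool.
by rewrite /edge finset.subUset !finset.sub1set.
Qed.

Lemma sum_mem_eq (A : {set 'I_n}) a : (\sum_(x in A) (x == a))%N = (a \in A).
Proof.
rewrite big_mkcond (bigD1 a) //= eqxx big1 ?addn0 => [|x /negPf ->]; last by case: ifP.
by case: (a \in A).
Qed.

Lemma volume_row om A :
  volume (row_graph om) A = (\sum_(q in arcs om) ((q.1 \in A) + (q.2 \in A)))%N.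
Proof.
rewrite /volume (eq_bigr _ (fun x _ => card_edges_pred om (fun e => x \in e))).
rewrite exchange_big /=; apply: eq_bigr => q; rewrite inE => /andP[lt _].
have ne : q.1 != q.2 by rewrite neq_ltn lt orbT.
rewrite (eq_bigr (fun x => (x == q.1) + (x == q.2))%N) => [|x _].
  by rewrite big_split /= !sum_mem_eq.
by rewrite /edge !inE; case: eqP => [->|_] //=; rewrite (negPf ne).
Qed.

Definition fiber (l : {ffun 'I_n -> 'I_k.+1}) (i : 'I_k.+1) : {set 'I_n} :=
  finset (fun u => l u == i).

Lemma sum_preim_partition (R : nmodType) (l : {ffun 'I_n -> 'I_k.+1}) (f : {set 'I_n} -> R) :
  f finset.set0 = 0 ->
  \sum_(A in preim_partition l [set: 'I_n]%SET) f A = \sum_i f (fiber l i).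
Proof.
move=> f0.
have -> : preim_partition l [set: 'I_n]%SET =
    finset.imset (fiber l) (mem (finset.imset l (mem [set: 'I_n]%SET))).
  rewrite -imset_comp; apply: eq_imset => x /=; apply/setP => y.
  by rewrite !inE eq_sym.
rewrite big_imset /=; last first.
  move=> i j /imsetP[x _ ->] _ /setP /(_ x); rewrite !inE eqxx => /esym/eqP //.
rewrite big_mkcond; apply: eq_bigr => i _; case: ifP => // /negP iN.
rewrite (_ : fiber l i = finset.set0) //; apply/setP => u; rewrite !inE.
by apply/negP => /eqP E; case: iN; rewrite -E imset_f.
Qed.

Variables (R : realType) (p : R).
Hypothesis p01 : 0 <= p <= 1.

Lemma sum_arcs om (F : 'I_n * 'I_n -> nat) :
  (\sum_(q in arcs om) F q)%:R =
  \sum_(v < n) \sum_(u < n | (u < v)%N) ((om v).1 u)%:R * (F (v, u))%:R :> R.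
Proof.
rewrite natr_sum big_mkcond /=.
transitivity (\sum_(v < n) \sum_(u < n) (if (v, u) \in arcs om then (F (v, u))%:R else 0 : R)).
  by rewrite pair_bigA; apply: eq_bigr => -[].
apply: eq_bigr => v _; rewrite [RHS]big_mkcond; apply: eq_bigr => u _; rewrite inE /=.
by case: (u < v)%N => //=; case: ((om v).1 u); rewrite ?mul1r ?mul0r.
Qed.

Lemma greedy_in om : (\sum_i edges_within (row_graph om) (fiber (greedy om) i))%:R =
  \sum_v F_in R (greedy om) v (om v) :> R.
Proof.
have -> : (\sum_i edges_within (row_graph om) (fiber (greedy om) i) =
    \sum_(q in arcs om) (greedy om q.2 == greedy om q.1))%N.
  rewrite (eq_bigr _ (fun i _ => edges_within_row om _)) exchange_big /=.
  apply: eq_bigr => q _; rewrite (bigD1 (greedy om q.1)) //= big1 => [|i].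
    by rewrite addn0 !inE eqxx.
  by rewrite !inE eq_sym => /negPf ->.
rewrite sum_arcs; apply: eq_bigr => v _; rewrite /F_in /F_fwd -greedyE big_mkcondr.
by apply: eq_bigr => u _ /=; case: eqP => _; rewrite ?mulr1 ?mulr0.
Qed.

Lemma greedy_volume om i : (volume (row_graph om) (fiber (greedy om) i))%:R =
  \sum_v F_back R i (greedy om) v (om v) + \sum_v F_fwd R i (greedy om) v (om v) :> R.
Proof.
rewrite volume_row sum_arcs -big_split; apply: eq_bigr => v _ /=.
rewrite /F_back /back /F_fwd -greedyE mulr_suml big_mkcondr -big_split /=.
apply: eq_bigr => u _; rewrite !inE natrD mulrDr; congr (_ + _).
by case: eqP => _; rewrite ?mulr1 ?mulr0.
Qed.

Lemma sum_volume_row om :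
  (\sum_i volume (row_graph om) (fiber (greedy om) i) = 2 * #|edges (row_graph om)|)%N.
Proof.
rewrite (eq_bigr _ (fun i _ => volume_row om _)) exchange_big card_row_edges -sum1_card /=.
rewrite big_distrr /=; apply: eq_bigr => q _; rewrite muln1 big_split /=.
have h v : (\sum_i (v \in fiber (greedy om) i) = 1)%N.
  rewrite (bigD1 (greedy om v)) //= inE eqxx big1 ?addn0 // => i.
  by rewrite inE eq_sym => /negPf ->.
by rewrite !h.
Qed.

Lemma max_modularity_ge om (m : R) : m = #|edges (row_graph om)|%:R ->
  (\sum_v F_in R (greedy om) v (om v)) / m
  - (\sum_i (\sum_v F_back R i (greedy om) v (om v) + \sum_v F_fwd R i (greedy om) v (om v)) ^+ 2)
     / (4 * m ^+ 2) <= max_modularity R (row_graph om).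
Proof.
move=> ->; set P := preim_partition (greedy om) [set: 'I_n]%SET.
apply: (@le_trans _ _ (modularity R (row_graph om) P)); last first.
  exact/le_bigmax_cond/preim_partitionP.
rewrite /modularity !sum_preim_partition.
- rewrite -natr_sum greedy_in le_eqVlt; apply/orP; left; apply/eqP; congr (_ - _ / _).
  by apply: eq_bigr => i _; rewrite greedy_volume.
- rewrite volume_row big1 ?expr0n // => q _; rewrite !inE //.
- by rewrite edges_within_row big1 // => q _; rewrite !inE.
Qed.

(** Each potential edge is read from exactly one row, that of its larger endpoint; the other entries
    and the rotation integrate to 1. *)
Lemma row_graph_weight (G : sgraph 'I_n) :
  \sum_(om : Om | row_graph om == G) \prod_v row_weight p (om v) =
  \prod_(e : {set 'I_n} | #|e| == 2) (if e \in edges G then p else 1 - p).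
Proof.
pose F (v : 'I_n) : pred Row :=
  fun t => [forall u : 'I_n, (u < v)%N ==> (t.1 u == (edge (v, u) \in edges G))].
rewrite (eq_bigl (fun om => om \in family F)); last first.
  move=> om /=; apply/eqP/familyP => [E v|h].
    by apply/forallP => u; apply/implyP => uv; rewrite -E edge_in_row_graph ?inE /=.
  apply: val_inj; apply/setP => e; rewrite /=; apply/idP/idP.
    move=> /imsetP[q qa ->]; have := qa; rewrite inE => /andP[lt ome].
    by have /forallP /(_ q.2) := h q.1; rewrite lt ome /=; case: q {qa lt ome} => a b /= /eqP <-.
  move=> eG; have /forallP /(_ e) := edges_card2 G; rewrite eG /= => /cards2P[a [b [ab E]]].
  have [q qb qE] : exists2 q, q \in below & e = edge q.
    move: ab; rewrite neq_ltn => /orP[lt|lt].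
      by exists (b, a); rewrite ?inE // E /edge /= finset.setUC.
    by exists (a, b); rewrite ?inE // E.
  rewrite qE edge_in_row_graph //; have := h q.1 => /forallP /(_ q.2).
  by move: qb; rewrite inE => -> /= /eqP ->; rewrite -surjective_pairing -qE.
rewrite -(bigA_distr_big_dep F (fun (v : 'I_n) t => row_weight p t)).
have rowE v : \sum_(t | F v t) row_weight p t =
    \prod_(u < n | (u < v)%N) bern p (edge (v, u) \in edges G).
  transitivity (Er p (fun t : Row => (F v t)%:R)).
    by rewrite /Er big_mkcond; apply: eq_bigr => t _; case: (F v t); rewrite ?mulr1 ?mulr0.
  rewrite Er_E.
  set b := \prod_(u < n | _) _.
  have E : Ex (bern p) (fun e : {ffun 'I_n -> bool} =>
      [forall u : 'I_n, (u < v)%N ==> (e u == (edge (v, u) \in edges G))]%:R) = b.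
    pose H (u : 'I_n) : pred bool := fun x => (u < v)%N ==> (x == (edge (v, u) \in edges G)).
    transitivity (\sum_(e in family H) \prod_u bern p (e u)).
      rewrite /Ex [RHS]big_mkcond; apply: eq_bigr => e _.
      have -> : (e \in family H) = [forall u, H u (e u)] by apply/familyP/forallP.
      by case: ifP; rewrite ?mulr1 ?mulr0.
    rewrite -(bigA_distr_big_dep H (fun (_ : 'I_n) x => bern p x)) /b [RHS]big_mkcond.
    apply: eq_bigr => u _; rewrite /H; case: (u < v)%N => /=; last exact: bern_sum.
    by rewrite big_pred1_eq.
  rewrite (eq_bigr (fun=> b)) => [|tau _]; last exact: E.
  by rewrite sumr_const card_ord -[_ *+ _]mulr_natr mulfK ?pnatr_eq0.
rewrite (eq_bigr _ (fun v _ => rowE v)) pair_big_dep /=.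
transitivity (\prod_(e in finset.imset edge (mem below)) (if e \in edges G then p else 1 - p)).
  rewrite big_imset /=; last exact: edge_inj.
  by apply: eq_big => [q|[a b] _] //; rewrite inE.
apply: eq_bigl => e; apply/imsetP/cards2P => [[q]|[a [b [ab ->]]]].
  by rewrite inE => lt ->; exists q.1, q.2; rewrite neq_ltn lt orbT.
move: ab; rewrite neq_ltn => /orP[lt|lt].
  by exists (b, a); rewrite ?inE // /edge /= finset.setUC.
by exists (a, b); rewrite ?inE.
Qed.

Lemma gnp_prob_Ex (E : pred (sgraph 'I_n)) :
  gnp_prob p E = Ex (@row_weight R n k p) (fun om => (E (row_graph om))%:R).
Proof.
rewrite /Ex (partition_big row_graph predT) //= /gnp_prob big_mkcond; apply: eq_bigr => G _.
transitivity (\sum_(om : Om | row_graph om == G) (\prod_v row_weight p (om v)) * (E G)%:R); last first.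
  by apply: eq_bigr => om /eqP ->.
rewrite -mulr_suml row_graph_weight.
by case: (E G); rewrite ?mulr1 ?mulr0.
Qed.
End Graph.

(** * From the good event to the limit in probability *)

Section Limit.
Variables (R : realType) (k : nat).
Local Notation K := (k.+1%:R : R).

(** [N] stands for the number of vertices, [M] of edges, [F] of edges inside classes, [V i] for the
    volumes and [x] for the error per vertex. Each is replaced by its worst value. *)
Lemma modularity_perturb (N c A x F M : R) (V : 'I_k.+1 -> R) :
  0 < N -> 0 < c -> 0 <= x -> K * x < c -> 0 <= A -> N * A <= F ->
  (forall i, 0 <= V i <= N * (c / K + x)) -> `|2 * M - N * c| <= N * (K * x) ->
  2 * A / (c + K * x) - K * (c / K + x) ^+ 2 / (c - K * x) ^+ 2 <=
  F / M - (\sum_i V i ^+ 2) / (4 * M ^+ 2).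
Proof.
move=> N0 c0 x0 xc A0 AF hV; rewrite ler_norml => /andP[M1 M2].
have K0 : 0 < K by rewrite ltr0Sn.
have Kx0 : 0 <= K * x by rewrite mulr_ge0 // ltW.
have Mlo : N * (c - K * x) <= 2 * M by lra.
have Mhi : 2 * M <= N * (c + K * x) by lra.
have d0 : 0 < c - K * x by lra.
have Nd0 : 0 < N * (c - K * x) by exact: mulr_gt0.
have M0 : 0 < M by lra.
apply: lerB.
  apply: (@le_trans _ _ (N * A / M)); last by rewrite ler_wpM2r // invr_ge0 ltW.
  rewrite ler_pdivrMr; last lra.
  rewrite mulrAC ler_pdivlMr // -subr_ge0.
  have -> : N * A * (c + K * x) - 2 * A * M = A * (N * (c + K * x) - 2 * M) by ring.
  by rewrite mulr_ge0 // subr_ge0.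
apply: (@le_trans _ _ (K * (N * (c / K + x)) ^+ 2 / (N * (c - K * x)) ^+ 2)); last first.
  have cancel a d : d != 0 -> K * (N * a) ^+ 2 / (N * d) ^+ 2 = K * a ^+ 2 / d ^+ 2.
    by move=> dn0; field; rewrite dn0 gt_eqF.
  by rewrite cancel // gt_eqF.
have hS : \sum_i V i ^+ 2 <= K * (N * (c / K + x)) ^+ 2.
  have -> y : K * y = \sum_(i < k.+1) y by rewrite sumr_const card_ord mulr_natl.
  apply: ler_sum => i _; have /andP[v0 v1] := hV i.
  by rewrite lerXn2r ?nnegrE //; apply: le_trans v1.
have S0 : 0 <= \sum_i V i ^+ 2 by apply: sumr_ge0 => i _; apply: sqr_ge0.
apply: ler_pM => //; first by rewrite invr_ge0 mulr_ge0 // sqr_ge0.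
rewrite lef_pV2 ?posrE ?mulr_gt0 ?exprn_gt0 //.
have -> : 4 * M ^+ 2 = (2 * M) ^+ 2 by ring.
by rewrite lerXn2r // nnegrE; lra.
Qed.

Lemma modularity_perturb_ex (c I th : R) : 0 < c -> 0 <= th ->
  th < 2 * K / c ^+ 2 * I - K^-1 ->
  exists x, [/\ 0 < x, K * x < c, 0 <= K * I / c - x &
   th < 2 * (K * I / c - x) / (c + K * x) - K * (c / K + x) ^+ 2 / (c - K * x) ^+ 2].
Proof.
move=> c0 th0 hth; have K0 : 0 < K by rewrite ltr0Sn.
pose g (x : R) := 2 * (K * I / c - x) / (c + K * x) - K * (c / K + x) ^+ 2 / (c - K * x) ^+ 2.
have gc : g x @[x --> (0 : R)] --> g 0.
  have lin (a b : R) : (a + b * x) @[x --> (0 : R)] --> a + b * 0.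
    by apply: cvgD; [exact: cvg_cst | apply: cvgM; [exact: cvg_cst | exact: cvg_id]].
  rewrite /g; apply: cvgB; apply: cvgM.
  - apply: cvgM; first exact: cvg_cst.
    by apply: cvgB; [exact: cvg_cst | exact: cvg_id].
  - by apply: cvgV; [rewrite mulr0 addr0 gt_eqF | exact: lin].
  - apply: cvgM; first exact: cvg_cst.
    by rewrite !expr2; apply: cvgM; apply: cvgD; (try exact: cvg_cst); exact: cvg_id.
  - apply: cvgV; first by rewrite mulr0 subr0 expf_neq0 // gt_eqF.
    rewrite !expr2; apply: cvgM; (apply: cvgB; first exact: cvg_cst);
    by apply: cvgM; [exact: cvg_cst | exact: cvg_id].
have g0 : g 0 = 2 * K / c ^+ 2 * I - K^-1.
  by rewrite /g !(mulr0, addr0, subr0); field; rewrite !gt_eqF.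
have A0 : 0 < K * I / c.
  have iK0 : 0 < K^-1 by rewrite invr_gt0.
  have : 0 < 2 * K / c ^+ 2 * I.
    by apply: lt_trans iK0 _; rewrite -subr_gt0; apply: le_lt_trans hth.
  have -> : 2 * K / c ^+ 2 * I = (2 / c) * (K * I / c) by field; rewrite gt_eqF.
  by rewrite pmulr_rgt0 // divr_gt0.
have [d /= d0 hd] : \forall x \near (0 : R), th < g x.
  by apply: (cvgr_gt _ gc); rewrite g0.
(* One term for each demand: closeness to 0, [K x < c], and a nonnegative main term. *)
pose x := Num.min (d / 2) (Num.min (c / K / 2) (K * I / c)).
have x0 : 0 < x by rewrite !lt_min A0 andbT; apply/andP; split; rewrite !divr_gt0.
exists x; split=> //.
- apply: (@le_lt_trans _ _ (K * (c / K / 2))).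
    by rewrite ler_pM2l // /x !ge_min lexx !orbT.
  have -> : K * (c / K / 2) = c / 2 by field; rewrite gt_eqF.
  lra.
- by rewrite subr_ge0 /x !ge_min lexx !orbT.
- apply: hd; rewrite /ball_ /= sub0r normrN gtr0_norm //.
  by apply: (@le_lt_trans _ _ (d / 2)); [rewrite /x !ge_min lexx | lra].
Qed.

Lemma sum_index n (p : R) : (2 * \sum_(v < n) p * v%:R / K) * K = p * n%:R * (n%:R - 1).
Proof.
elim: n => [|n IH]; first by rewrite big_ord0 !(mulr0, mul0r).
rewrite big_ord_recr /= mulrDr mulrDl IH -natr1; field.
by rewrite addrC natr1 pnatr_eq0.
Qed.

Lemma max_modularity_greedy n J (c I x e : R) (om : {ffun 'I_n -> {ffun 'I_n -> bool} * 'I_k.+1}) :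
  (0 < n)%N -> 0 < c -> c <= n%:R -> 0 < x -> K * x < c -> 0 <= K * I / c - x ->
  integral_ge (emax k.+1 J) 0 (c / K) I ->
  3 * e + c / (K * n%:R) <= x ->
  (K ^+ 2 + 1) * e + J%:R / n%:R + (J * k.+1)%:R * (expR (c / n%:R * J%:R) - 1) <= x ->
  ~~ bad (c / n%:R) e om ->
  2 * (K * I / c - x) / (c + K * x) - K * (c / K + x) ^+ 2 / (c - K * x) ^+ 2 <=
  max_modularity R (row_graph om).
Proof.
move=> n0 c0 cn x0 Kxc A0 hI h3 h1 good; have N0 : 0 < n%:R :> R by rewrite ltr0n.
have K0 : 0 < K by rewrite ltr0Sn.
have K0' : 0 < 1 + k%:R :> R by rewrite addrC natr1.
have p0 : 0 < c / n%:R by rewrite divr_gt0.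
have p01 : 0 <= c / n%:R <= 1 by rewrite (ltW p0) ler_pdivrMr // mul1r.
have np : n%:R * (c / n%:R) = c by rewrite mulrC divfK // gt_eqF.
apply: le_trans (max_modularity_ge (om := om) erefl).
pose W (i : 'I_k.+1) : R :=
  \sum_v F_back R i (greedy om) v (om v) + \sum_v F_fwd R i (greedy om) v (om v).
pose m : R := 2 * \sum_(v < n) (c / n%:R) * v%:R / K.
(* The indices run up to [n - 1], so the target volume is [n c / K - c / K]; this deficit is the
   source of [c / (K n)] in the hypothesis on [x]. *)
have mE : m * K = c * n%:R - c by rewrite /m sum_index divfK ?gt_eqF // mulrBr mulr1.
have hW i : `|W i - m| <= 3 * (e * n%:R) := good_volume p01 i good.
have hx : 3 * (e * n%:R) + c / K <= n%:R * x.
  have -> : 3 * (e * n%:R) + c / K = n%:R * (3 * e + c / (K * n%:R)).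
    by field; rewrite !gt_eqF.
  by rewrite ler_wpM2l // ltW.
have mE' : m = n%:R * (c / K) - c / K.
  apply: (mulIf (lt0r_neq0 K0)); rewrite mE.
  by field; rewrite gt_eqF.
have cK0 : 0 < c / K by rewrite divr_gt0.
apply: (@modularity_perturb n%:R) => //; first exact: ltW.
- apply: le_trans (good_in p01 J good).
  have hr := @riemann_emax n k R (c / n%:R) J I p0.
  rewrite np in hr; have {hr} := hr hI.
  have -> : K / (c / n%:R) * I = n%:R * (K * I / c) by field; rewrite !gt_eqF.
  set S := \sum_(v < n) _ => hS.
  have : n%:R * ((K ^+ 2 + 1) * e + J%:R / n%:R + (J * k.+1)%:R * (expR (c / n%:R * J%:R) - 1)) <= n%:R * x.
    by rewrite ler_wpM2l // ltW.
  have -> : forall y : R, n%:R * ((K ^+ 2 + 1) * e + J%:R / n%:R + y) = n%:R * y + (K ^+ 2 + 1) * (e * n%:R) + J%:R.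
    by move=> y; field; rewrite gt_eqF.
  lra.
- move=> i; apply/andP; split; first by rewrite -greedy_volume ler0n.
  change (W i <= n%:R * (c / K + x)); have := hW i.
  by move: hx cK0; rewrite mE' ler_norml; move: (c / K) (W i) => a b ? ? /andP[_]; lra.
(* The number of edges needs no separate concentration bound: twice it is the sum of the class
   volumes. *)
have -> : 2 * #|row_graph om|%:R = \sum_i W i :> R.
  by rewrite -natrM -sum_volume_row natr_sum; apply: eq_bigr => i _; apply: greedy_volume.
have -> : n%:R * c = \sum_(i < k.+1) n%:R * (c / K).
  by rewrite sumr_const card_ord -[RHS]mulr_natl; field; rewrite gt_eqF.
rewrite -sumrB; apply: le_trans (ler_norm_sum _ _ _) _.
have -> : n%:R * (K * x) = \sum_(i < k.+1) n%:R * x.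
  by rewrite sumr_const card_ord -[RHS]mulr_natl; ring.
apply: ler_sum => i _; have := hW i; rewrite mE' !ler_norml.
by move: hx cK0; move: (c / K) (W i) => a b ? ? /andP[? ?]; apply/andP; split; lra.
Qed.

Lemma cvg_inv_nat : (n%:R^-1 : R) @[n --> \oo] --> (0 : R).
Proof.
apply/gtr0_cvgV0; last exact: cvgr_idn.
by exists 1%N => // n /= n0; rewrite ltr0n.
Qed.

Lemma cvg_inv_sqrt_nat : ((Num.sqrt (n%:R : R))^-1 : R) @[n --> \oo] --> (0 : R).
Proof.
have -> : (fun n : nat => (Num.sqrt (n%:R : R))^-1) = (fun n => Num.sqrt (n%:R^-1 : R)).
  by apply/funext => n; rewrite sqrtrV.
rewrite -[X in _ --> X]sqrtr0; apply: continuous_cvg cvg_inv_nat; exact: sqrt_continuous.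
Qed.

Lemma gnp_max_modularity (c I th : R) J : 0 < c -> 0 <= th ->
  th < 2 * K / c ^+ 2 * I - K^-1 -> integral_ge (emax k.+1 J) 0 (c / K) I ->
  (fun n : nat => gnp_prob (c / n%:R) (fun G : sgraph 'I_n => th < max_modularity R G))
  @ \oo --> (1 : R).
Proof.
move=> c0 th0 hth hI; have K0 : 0 < K by rewrite ltr0Sn.
have K0' : 0 < 1 + k%:R :> R by rewrite addrC natr1.
have [x [x0 Kxc A0 hx]] := modularity_perturb_ex c0 th0 hth.
(* Half of the error budget [x] goes to the tolerance [e], whose coefficients [3] and [K^2 + 1] are
   both at most [K^2 + 3]; the other half absorbs the terms vanishing with [n]. *)
pose e := x / 2 / (K ^+ 2 + 3).
have D0 : 0 < K ^+ 2 + 3 by rewrite ltr_wpDl ?sqr_ge0.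
have e0 : 0 < e by rewrite !divr_gt0.
have eE : (K ^+ 2 + 3) * e = x / 2 by rewrite mulrC divfK // gt_eqF.
pose B n : R := (2 * k.+1 + 1)%:R * ((2 * c + 2 * c ^+ 2) / e ^+ 2 * n%:R^-1) +
  K * (c / e * (Num.sqrt n%:R)^-1).
have Bc : B n @[n --> \oo] --> (0 : R).
  rewrite -(addr0 0) -[X in _ --> X + _](mulr0 (2 * k.+1 + 1)%:R) -[X in _ --> _ + X](mulr0 K).
  apply: cvgD; apply: cvgM; try exact: cvg_cst.
    rewrite -[X in _ --> X](mulr0 ((2 * c + 2 * c ^+ 2) / e ^+ 2)).
    by apply: cvgM; [exact: cvg_cst | exact: cvg_inv_nat].
  rewrite -[X in _ --> X](mulr0 (c / e)).
  by apply: cvgM; [exact: cvg_cst | exact: cvg_inv_sqrt_nat].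
have hc : \forall n \near \oo, c <= n%:R by exact: nbhs_infty_ger.
have E1 : (c / K * n%:R^-1 : R) @[n --> \oo] --> (0 : R).
  rewrite -[X in _ --> X](mulr0 (c / K)).
  by apply: cvgM; [exact: cvg_cst | exact: cvg_inv_nat].
have E2 : (J%:R * n%:R^-1 + (J * k.+1)%:R * (expR (c * J%:R * n%:R^-1) - 1) : R)
    @[n --> \oo] --> (0 : R).
  have -> : (0 : R) = J%:R * 0 + (J * k.+1)%:R * (expR (c * J%:R * 0) - 1).
    by rewrite !mulr0 expR0 subrr mulr0 addr0.
  apply: cvgD; first by apply: cvgM; [exact: cvg_cst | exact: cvg_inv_nat].
  apply: cvgM; first exact: cvg_cst.
  apply: cvgB; last exact: cvg_cst.
  apply: continuous_cvg; first exact: continuous_expR.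
  by apply: cvgM; [exact: cvg_cst | exact: cvg_inv_nat].
have x2 : 0 < x / 2 by rewrite divr_gt0.
have K20 : 0 <= K ^+ 2 := sqr_ge0 K.
have h1 : \forall n \near \oo, c / K * n%:R^-1 < x / 2 by exact: (cvgr_lt _ E1).
have h2 : \forall n \near \oo,
    J%:R * n%:R^-1 + (J * k.+1)%:R * (expR (c * J%:R * n%:R^-1) - 1) < x / 2.
  exact: (cvgr_lt _ E2).
apply: (@squeeze_cvgr _ _ _ _ (fun n => 1 - B n) (fun=> 1)); last exact: cvg_cst.
  near=> n.
  have n0 : (0 < n)%N by near: n; exists 1%N.
  have cn : c <= n%:R by near: n.
  have N0 : 0 < n%:R :> R by rewrite ltr0n.
  have p01 : 0 <= c / n%:R <= 1.
    by rewrite (ltW (divr_gt0 c0 N0)) ler_pdivrMr // mul1r.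
  have np : n%:R * (c / n%:R) = c by rewrite mulrC divfK // gt_eqF.
  have w0 := row_weight_ge0 (n := n) (k := k) p01.
  have w1 := row_weight_sum n k (c / n%:R).
  rewrite (gnp_prob_Ex k); apply/andP; split; last first.
    rewrite -[leRHS](Ex_const 'I_n w1 1); apply: Ex_le => // om; rewrite lern1; exact: leq_b1.
  have hB : Ex (@row_weight R n k (c / n%:R)) (fun om => (bad (c / n%:R) e om)%:R) <= B n.
    apply: le_trans (Ex_bad k p01 n0 e0) _.
    rewrite le_eqVlt; apply/orP; left; apply/eqP; rewrite /B /row_var np.
    by field; rewrite !gt_eqF ?sqrtr_gt0.
  apply: (@le_trans _ _ (1 - Ex (@row_weight R n k (c / n%:R)) (fun om => (bad (c / n%:R) e om)%:R))).
    by rewrite lerD2l lerN2.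
  rewrite -[X in X - _](Ex_const 'I_n w1 1) -Ex_sub; apply: Ex_le => // om.
  case: (boolP (bad _ e om)) => [_|good]; first by rewrite subrr.
  rewrite subr0 ler1n lt0b; apply: lt_le_trans hx _.
  have l1 : c / K * n%:R^-1 < x / 2 by near: n.
  have l2 : J%:R * n%:R^-1 + (J * k.+1)%:R * (expR (c * J%:R * n%:R^-1) - 1) < x / 2 by near: n.
  apply: (@max_modularity_greedy n J c I x e) => //.
    have -> : c / (K * n%:R) = c / K * n%:R^-1 by field; rewrite !gt_eqF.
    have : 0 <= K ^+ 2 * e by rewrite mulr_ge0 // ltW.
    by move: l1 eE; move: (c / K * n%:R^-1) (K ^+ 2) => a b ? ? ?; lra.
  rewrite [c / n%:R * _]mulrAC -addrA.
  by move: l2 eE; move: (_ + _ * (_ - 1)) (K ^+ 2) => a b ? ?; lra.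
rewrite -[X in _ --> X]subr0; apply: cvgB Bc; exact: cvg_cst.
Unshelve. all: by end_near.
Qed.
End Limit.

Theorem theorem4p5 (R : realType) (c : R) (hc : 1 < c) :
  (fun n : nat => gnp_prob (c / n%:R)
     (fun G : sgraph 'I_n => 668 / 1000 / Num.sqrt c < max_modularity R G))
  @ \oo --> (1 : R).
Proof.
have c0 : 0 < c by lra.
have th0 : 0 <= 668 / 1000 / Num.sqrt c.
  by apply: divr_ge0; [lra | exact: sqrtr_ge0].
have [c6|c6] := lerP c 6.
  have [k [I [hI h]]] := integral_emax_small (ltW hc) c6.
  exact: gnp_max_modularity c0 th0 h hI.
have [J [I [hI h]]] := integral_emax_large (ltW c6).
exact: (@gnp_max_modularity R 4 c I _ J c0 th0 h hI).
Qed.
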